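(* For each fixed integer $m\ge 1$, as $n\to\infty$, $$\sum_{0\le k\le \lambda}\left|\mathbb{P}(X_n=k)-\sum_{0\le r<m}(-1)^r a_r(n)\,2^{-\lambda}\Delta^r\binom{\lambda}{k}\right| = \frac{h_m\,|a_m(n)|}{(\log_2 n)^{m/2}}+O\left((\log n)^{-(m+1)/2}\right).$$
   Context: For an integer $n\ge 1$, $\lambda=\lfloor\log_2 n\rfloor$, and $n=\sum_{1\le j\le s}2^{\lambda_j}$ with $\lambda=\lambda_1>\lambda_2>\cdots>\lambda_s\ge 0$ is the binary expansion of $n$. $X_n$ is the number of 1s in the binary representation of a random integer chosen uniformly from $\{0,1,\ldots,n-1\}$. The sequence $a_r(n)$ ($r\ge0$), which satisfies $a_r(n)=a_r(2n)$, is defined by the power series expansion at $y=1$ $$\mathbb{E}(y^{X_n})\left(\frac{1+y}{2}\right)^{-\lambda}=\frac1n\sum_{1\le j\le s}2^{\lambda_j}y^{j-1}\left(\frac{1+y}{2}\right)^{\lambda_j-\lambda}=\sum_{r\ge0}a_r(n)(y-1)^r .$$ $\Delta$ is the difference operator: $\Delta^r\binom{\lambda}{k}=\sum_{0\le \ell\le r}\binom{r}{\ell}(-1)^\ell\binom{\lambda}{k-\ell}$, with $\binom{\lambda}{i}=0$ for $i<0$ or $i>\lambda$. $H_m(x)=(-1)^m e^{x^2/2}\frac{d^m}{dx^m}e^{-x^2/2}$ are the Hermite polynomials and $$h_m=\frac{2^{m}}{\sqrt{2\pi}}\int_{-\infty}^{\infty}|H_m(x)|e^{-x^2/2}\,dx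 .$$ *)

(* Defs.v *)
From mathcomp Require Import all_boot all_order all_algebra.
From mathcomp Require Import all_classical all_reals all_analysis.

Set Implicit Arguments.
Unset Strict Implicit.
Unset Printing Implicit Defensive.

Import Order.TTheory GRing.Theory Num.Theory.
Import numFieldNormedType.Exports.

Local Open Scope classical_set_scope.
Local Open Scope ring_scope.

(* The number of 1s in binary; the bits of index > i all vanish, as i < 2 ^ i. *)
Definition sum_of_digits (i : nat) : nat := (\sum_(j < i.+1) odd (i %/ 2 ^ j))%N.

(* floor (log_2 n) *)
Definition floor_log2 (n : nat) : nat := trunc_log 2 n.

Section BinomialApproximation.
Variable R : realType.

(* P(X_n = k), where X_n is the number of 1s in the binary representation of a
   uniformly random element of {0, ..., n - 1}. *)
Definition prob_digits (n k : nat) : R :=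
  #|[pred i : 'I_n | sum_of_digits i == k]|%:R / n%:R.

(* E(y ^ X_n) *)
Definition pgf_digits (n : nat) (y : R) : R :=
  (\sum_(i < n) y ^+ sum_of_digits i) / n%:R.

Definition normalized_pgf (n : nat) (y : R) : R :=
  pgf_digits n y * ((1 + y) / 2) ^- floor_log2 n.

(* a_r(n): the coefficient of (y - 1)^r in the power series expansion of
   normalized_pgf n at y = 1, i.e. its r-th Taylor coefficient there. *)
Definition expansion_coef (r n : nat) : R :=
  derive1n r (normalized_pgf n) 1 / r`!%:R.

(* Delta^r binomial(l, k). Terms with j > k are dropped explicitly because the
   subtraction on nat is truncated; 'C(l, i) is already 0 for i > l. *)
Definition diff_binomial (r l k : nat) : R :=
  \sum_(j < r.+1 | (j <= k)%N) 'C(r, j)%:R * (-1) ^+ j * 'C(l, k - j)%:R.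

Definition hermite (m : nat) (x : R) : R :=
  (-1) ^+ m * expR (x ^+ 2 / 2) *
  derive1n m (fun t : R => expR (- (t ^+ 2 / 2))) x.

Definition hermite_const (m : nat) : R :=
  2 ^+ m / Num.sqrt (2 * pi) *
  \int[lebesgue_measure]_x (`|hermite m x| * expR (- (x ^+ 2 / 2))).

Definition log2 (x : R) : R := ln x / ln 2.

End BinomialApproximation.

(* Main.v *)
Require Import Defs.
From mathcomp Require Import all_boot all_order all_algebra.
From mathcomp Require Import all_classical all_reals all_analysis.
From mathcomp Require Import measurable_realfun ring lra zify.

(** Write [t = y - 1] and [u = (1 + y) / 2], and measure polynomials by the sum of
    the absolute values of their coefficients, so that the left-hand side of the
    theorem is such a norm.  The generating function of [X_n] is a combination of
    terms [y ^ a * u ^ (lambda - d)] with [a <= d] and weights at most [2 ^ - d], one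
    for each bit of [n] ([digit_poly_expansion]).

    Both [y ^ a] and [u ^ - d] can be expanded at [y = 1] by telescoping geometric
    sums, and each step extracts a factor [t] from a combination of polynomially many
    (in [d]) terms of the same shape.  Hence the generating function is
    [\sum_(r <= m) a_r * t ^ r * u ^ lambda] plus a remainder whose norm is at most
    the sum over [d] of [2 ^ - d * poly(d)] times the norm of
    [t ^ (m + 1) * u ^ (lambda - d)]
    ([l1norm_taylor_remainder], [l1norm_remainder]).  Here [t ^ r * u ^ lambda] is the
    [r]-th difference of the binomial distribution, up to sign, and the [a_r] are
    indeed the Taylor coefficients of the statement ([derive1n_quot]).

    It remains to evaluate the norm of [t ^ m * u ^ l].  With [N = m + l], its
    coefficient at [y ^ k] is [2 ^ m * N ^ (- m / 2)] times the binomial weight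
    [2 ^ - N * 'C(N, k)] times a normalized Krawtchouk polynomial at
    [x = (2 k - N) / sqrt N] ([krawtchouk_coefE]).  The three-term recurrence of these
    polynomials is that of the Hermite polynomials up to a relative error [O(1 / N)].
    So the norm of [t ^ m * u ^ l] is [2 ^ m * N ^ (- m / 2)] times the mean of
    [`|H_m|] under the standardized binomial law, up to [O(N ^ (- 1 / 2))] in that mean
    when the few terms with [k > l] are dropped ([l1norm_difference_asymptotics]).  As the
    moments are bounded, the same formula gives the bound [O(l ^ (- r / 2))] used
    for the remainder ([l1norm_difference_bound]).

    Finally the binomial mean of [`|H_m|] is within [O(N ^ (- 1 / 2))] of its Gaussian
    mean, by Stein's method ([binomial_clt]).  The method applies to functions with a
    locally Lipschitz bound of polynomial growth, such as [`|H_m|], and the Gaussian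
    mean enters it through the solvability of the Stein equation. *)

Set Implicit Arguments.
Unset Strict Implicit.
Unset Printing Implicit Defensive.

Import Order.TTheory GRing.Theory Num.Theory.
Import numFieldNormedType.Exports.

Local Open Scope classical_set_scope.
Local Open Scope ring_scope.

(** * The coefficient norm and Taylor expansion of polynomials *)

Section TruncatedNorm.
Variable R : realType.
Implicit Types p q : {poly R}.

(** Cutting at [n] matches the range [0 <= k <= lambda] of the theorem, and makes the
    bounds for sums and shifts independent of degrees. *)
Definition l1norm (n : nat) p : R := \sum_(k < n) `|p`_k|.

Lemma l1norm_ge0 n p : 0 <= l1norm n p.
Proof. exact: sumr_ge0. Qed.

Lemma l1normD n p q : l1norm n (p + q) <= l1norm n p + l1norm n q.
Proof.
by rewrite -big_split; apply: ler_sum => i _; rewrite coefD ler_normD.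
Qed.

Lemma l1normZ n c p : l1norm n (c *: p) = `|c| * l1norm n p.
Proof. by rewrite mulr_sumr; apply: eq_bigr => i _; rewrite coefZ normrM. Qed.

Lemma l1norm_sum n (I : Type) (r : seq I) (F : I -> {poly R}) :
  l1norm n (\sum_(i <- r) F i) <= \sum_(i <- r) l1norm n (F i).
Proof.
elim/big_ind2: _ => [|p x q y px qy|//].
  by rewrite /l1norm big1 // => i _; rewrite coef0 normr0.
by apply: le_trans (l1normD _ _ _) _; exact: lerD.
Qed.

Lemma l1normXM n p : l1norm n ('X * p) <= l1norm n p.
Proof.
case: n => [|n]; first by rewrite /l1norm !big_ord0.
rewrite /l1norm big_ord_recl big_ord_recr /= mulrC coefMX normr0 add0r.
rewrite -[leLHS]addr0; apply: lerD => //.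
by apply: ler_sum => i _; rewrite coefMX.
Qed.

Lemma l1normXnM n a p : l1norm n ('X^a * p) <= l1norm n p.
Proof.
elim: a => [|a IH]; first by rewrite expr0 mul1r.
by rewrite exprS -mulrA (le_trans (l1normXM _ _)).
Qed.

(** The generating polynomial of one fair bit.  Multiplication by it averages
    a polynomial with its shift, so it does not increase the norm. *)
Definition fair_bit : {poly R} := 2^-1 *: (1 + 'X).
Local Notation u := fair_bit.

Lemma l1norm_fair_bitM n p : l1norm n (u * p) <= l1norm n p.
Proof.
rewrite /u -scalerAl l1normZ mulrDl mul1r ger0_norm ?invr_ge0 //.
have := l1normD n p ('X * p); have := l1normXM n p; lra.
Qed.

Lemma l1norm_fair_bitXM n d p : l1norm n (u ^+ d * p) <= l1norm n p.
Proof.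
elim: d => [|d IH]; first by rewrite expr0 mul1r.
by rewrite exprS -mulrA (le_trans (l1norm_fair_bitM _ _)).
Qed.

Local Notation t := ('X - 1 : {poly R}).

(** [taylor_coef r a d] is the coefficient of [(y - 1) ^ r] in the expansion of
    [y ^ a * ((1 + y) / 2) ^ - d] at [y = 1], computed with the telescoping
    identity [telescope_monomial]. *)
Fixpoint taylor_coef (r a d : nat) : R :=
  if r is r'.+1 then
    \sum_(i < a) taylor_coef r' i d - 2^-1 * \sum_(i < d) taylor_coef r' 0 i.+1
  else 1.

(** The geometric sums for [y ^ a - 1] and [u ^ - d - 1] both carry a factor [y - 1]. *)
Lemma telescope_monomial a d L : (d <= L)%N ->
  'X^a * u ^+ (L - d) = u ^+ L +
   t * (\sum_(i < a) 'X^i * u ^+ (L - d)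
        - 2^-1 *: \sum_(i < d) u ^+ (L - i.+1)).
Proof.
move=> dL; rewrite mulrBr.
have -> : t * (\sum_(i < a) 'X^i * u ^+ (L - d)) = ('X^a - 1) * u ^+ (L - d).
  by rewrite -mulr_suml mulrA -subrX1.
suff -> : t * (2^-1 *: \sum_(i < d) u ^+ (L - i.+1)) = u ^+ L - u ^+ (L - d).
  by rewrite mulrBl mul1r opprB; ring.
have tu : 2^-1 *: t = u - 1.
  rewrite /u scalerBr scalerDr.
  have E : 2^-1 *: (1 : {poly R}) + 2^-1 *: 1 = 1.
    by rewrite -scalerDl (_ : 2^-1 + 2^-1 = 1 :> R) ?scale1r //; lra.
  by rewrite -[X in _ = _ - X]E; ring.
rewrite -scalerAr scalerAl tu.
elim: d dL => [|d IH] dL; first by rewrite big_ord0 mulr0 subn0 subrr.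
rewrite big_ord_recr /= mulrDr IH ?(ltnW dL) //.
have -> : (L - d = (L - d.+1).+1)%N by lia.
by rewrite mulrBl -exprS; ring.
Qed.

Definition taylor_remainder r a d L : {poly R} :=
  'X^a * u ^+ (L - d) - \sum_(i < r) taylor_coef i a d *: (t ^+ i * u ^+ L).

Lemma taylor_remainderS r a d L : (d <= L)%N ->
  taylor_remainder r.+1 a d L =
    t * (\sum_(i < a) taylor_remainder r i d L
         - 2^-1 *: \sum_(i < d) taylor_remainder r 0 i.+1 L).
Proof.
move=> dL; rewrite /taylor_remainder telescope_monomial // big_ord_recl /= scale1r.
rewrite expr0 mul1r opprD addrACA subrr add0r.
have -> : \sum_(i < r) taylor_coef (bump 0 i) a d *: (t ^+ bump 0 i * u ^+ L) =
  t * (\sum_(i < a) \sum_(j < r) taylor_coef j i d *: (t ^+ j * u ^+ L)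
       - 2^-1 *: \sum_(i < d) \sum_(j < r) taylor_coef j 0 i.+1 *: (t ^+ j * u ^+ L)).
  rewrite exchange_big /= [X in _ *: X]exchange_big /= scaler_sumr -sumrB mulr_sumr.
  apply: eq_bigr => i _; rewrite /bump /= add1n exprS -mulrA scalerAr.
  by rewrite -!scaler_suml scalerA -scalerBl.
rewrite -mulrBr !sumrB scalerBr; congr (_ * _).
under [X in _ = _ - (_ *: X - _)]eq_bigr => i _ do rewrite expr0 mul1r.
by ring.
Qed.

Lemma taylor_remainder_dvd r a d L : (d <= L)%N ->
  exists q, taylor_remainder r a d L = t ^+ r * q.
Proof.
elim: r a d => [|r IH] a d dL.
  by exists (taylor_remainder 0 a d L); rewrite expr0 mul1r.
have [F FE] : exists F : nat -> {poly R}, forall i, taylor_remainder r i d L = t ^+ r * F i.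
  have /choice[F FE] := fun i => IH i d dL.
  by exists F.
have [G GE] : exists G : nat -> {poly R},
    forall i, (i < d)%N -> taylor_remainder r 0 i.+1 L = t ^+ r * G i.
  have /choice[G GE] : forall i, exists q, (i < d)%N ->
      taylor_remainder r 0 i.+1 L = t ^+ r * q.
    move=> i; case: (ltnP i d) => [id|_]; last by exists 0.
    by have [q qE] := IH 0%N i.+1 (leq_trans id dL); exists q.
  by exists G.
exists (\sum_(i < a) F i - 2^-1 *: \sum_(i < d) G i).
rewrite taylor_remainderS // exprS -mulrA; congr (_ * _).
rewrite mulrBr mulr_sumr -scalerAr mulr_sumr.
congr (_ - _ *: _); apply: eq_bigr => i _; first exact: FE.
exact/GE.
Qed.

Lemma taylor_coef_bound r a d D : (a <= D)%N -> (d <= D)%N ->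
  `|taylor_coef r a d| <= (2 * D)%:R ^+ r.
Proof.
elim: r a d => [|r IH] a d aD dD; first by rewrite normr1 expr0.
rewrite exprS /=; apply: le_trans (ler_normB _ _) _.
rewrite normrM (ger0_norm (_ : 0 <= 2^-1)) ?invr_ge0 //.
have A : `|\sum_(i < a) taylor_coef r i d| <= a%:R * (2 * D)%:R ^+ r.
  apply: le_trans (ler_norm_sum _ _ _) _.
  rewrite -[a in leRHS]card_ord -sum1_card natr_sum mulr_suml.
  by apply: ler_sum => i _; rewrite mul1r IH // (leq_trans _ aD) // ltnW.
have B : `|\sum_(i < d) taylor_coef r 0 i.+1| <= d%:R * (2 * D)%:R ^+ r.
  apply: le_trans (ler_norm_sum _ _ _) _.
  rewrite -[d in leRHS]card_ord -sum1_card natr_sum mulr_suml.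
  by apply: ler_sum => i _; rewrite mul1r IH // (leq_trans _ dD).
have P : 0 <= (2 * D)%:R ^+ r :> R by rewrite exprn_ge0.
have aD' : a%:R <= D%:R :> R by rewrite ler_nat.
have dD' : d%:R <= D%:R :> R by rewrite ler_nat.
rewrite natrM; move: A B P; rewrite natrM; set x := _ ^+ r => A B P.
have : 0 <= D%:R * x by rewrite mulr_ge0.
have : a%:R * x <= D%:R * x by rewrite ler_wpM2r.
have : d%:R * x <= D%:R * x by rewrite ler_wpM2r.
lra.
Qed.

(** Each step of the expansion extracts one factor [y - 1] at the price of at
    most [2 * D] terms of the same shape, and a factor [y ^ a] or
    [((1 + y) / 2) ^ e] cannot increase the norm. *)
Lemma l1norm_taylor_remainder n r s a d D L :
  (a <= D)%N -> (d <= D)%N -> (D <= L)%N ->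
  l1norm n (t ^+ s * taylor_remainder r a d L) <=
  (2 * D)%:R ^+ r * l1norm n (t ^+ (s + r) * u ^+ (L - D)).
Proof.
elim: r s a d => [|r IH] s a d aD dD DL.
  rewrite expr0 mul1r addn0 /taylor_remainder big_ord0 subr0.
  have -> : (L - d = (D - d) + (L - D))%N by lia.
  rewrite exprD mulrCA; apply: le_trans (l1normXnM _ _ _) _.
  by rewrite mulrCA l1norm_fair_bitXM.
rewrite taylor_remainderS ?(leq_trans dD) // mulrA -exprSr [(2 * D)%:R ^+ _]exprS addnS -addSn.
set x := l1norm n (t ^+ (s.+1 + r) * _).
rewrite mulrBr -scalerAr -scaleNr.
apply: le_trans (l1normD _ _ _) _.
rewrite l1normZ normrN (ger0_norm (_ : 0 <= 2^-1)) ?invr_ge0 //.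
have A : l1norm n (t ^+ s.+1 * \sum_(i < a) taylor_remainder r i d L) <=
         a%:R * ((2 * D)%:R ^+ r * x).
  rewrite mulr_sumr; apply: le_trans (l1norm_sum _ _ _) _.
  rewrite -[a in leRHS]card_ord -sum1_card natr_sum mulr_suml.
  apply: ler_sum => i _; rewrite mul1r IH //.
  by rewrite (leq_trans _ aD) // ltnW.
have B : l1norm n (t ^+ s.+1 * \sum_(i < d) taylor_remainder r 0 i.+1 L) <=
         d%:R * ((2 * D)%:R ^+ r * x).
  rewrite mulr_sumr; apply: le_trans (l1norm_sum _ _ _) _.
  rewrite -[d in leRHS]card_ord -sum1_card natr_sum mulr_suml.
  apply: ler_sum => i _; rewrite mul1r IH //.
  by rewrite (leq_trans _ dD).
have P : 0 <= (2 * D)%:R ^+ r * x by rewrite mulr_ge0 ?exprn_ge0 ?l1norm_ge0.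
have aD' : a%:R <= D%:R :> R by rewrite ler_nat.
have dD' : d%:R <= D%:R :> R by rewrite ler_nat.
rewrite -mulrA; move: A B P; set z := _ * x => A B P; rewrite natrM.
have : 0 <= D%:R * z by rewrite mulr_ge0.
have : a%:R * z <= D%:R * z by rewrite ler_wpM2r.
have : d%:R * z <= D%:R * z by rewrite ler_wpM2r.
lra.
Qed.

End TruncatedNorm.

(** * Taylor coefficients as derivatives *)

Section TaylorCoefficients.
Variable R : realType.
Implicit Types (p q : {poly R}) (c : nat -> R).
Local Notation u := (fair_bit R).
Local Notation t := ('X - 1 : {poly R}).

Lemma horner_fair_bit x : u.[x] = (1 + x) / 2.
Proof. by rewrite /fair_bit !hornerE mulrC. Qed.

Lemma deriv_fair_bit : u^`() = (2^-1)%:P.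
Proof. by rewrite /fair_bit !poly.derivE add0r alg_polyC. Qed.

(** The numerator, over [u ^ L.+1], of the derivative of [p / u ^ L]. *)
Definition quot_deriv L p : {poly R} := p^`() * u - (L%:R / 2) *: p.

Lemma quot_deriv_sum L (I : Type) (r : seq I) (F : I -> {poly R}) :
  quot_deriv L (\sum_(i <- r) F i) = \sum_(i <- r) quot_deriv L (F i).
Proof.
rewrite /quot_deriv (raddf_sum (@deriv R)) mulr_suml scaler_sumr -sumrB.
by apply: eq_bigr.
Qed.

Lemma quot_derivD L p q :
  quot_deriv L (p + q) = quot_deriv L p + quot_deriv L q.
Proof. by rewrite /quot_deriv derivD mulrDl scalerDr opprD addrACA. Qed.

Lemma quot_derivZ L a p : quot_deriv L (a *: p) = a *: quot_deriv L p.
Proof.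
by rewrite /quot_deriv derivZ -scalerAl scalerBr !scalerA [a * _]mulrC.
Qed.

Lemma deriv_subX1X i : (t ^+ i)^`() = i%:R *: t ^+ i.-1.
Proof. by rewrite deriv_exp derivB derivX (derivC 1) subr0 mul1r scaler_nat. Qed.

Lemma quot_deriv_difference L i :
  quot_deriv L (t ^+ i * u ^+ L) = i%:R *: (t ^+ i.-1 * u ^+ L.+1).
Proof.
rewrite /quot_deriv derivM deriv_subX1X deriv_exp deriv_fair_bit.
rewrite mulrDl -!scalerAl -mulrA -exprSr -[RHS]addr0 -addrA; congr (_ + _).
case: L => [|L]; first by rewrite mulr0n mulr0 mul0r mul0r scale0r subr0.
rewrite /= -mul_polyC polyCM polyC_natr exprSr.
by rewrite -mulr_natr; ring.
Qed.

Lemma quot_deriv_subX1M L r q : exists q',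
  quot_deriv L (t ^+ r.+1 * q) = t ^+ r * q'.
Proof.
exists (r.+1%:R *: (q * u) + t * q^`() * u - (L%:R / 2) *: (t * q)).
rewrite /quot_deriv derivM deriv_subX1X /= -!mul_polyC exprSr; ring.
Qed.

Lemma is_derive_quot L p (x : R) : -1 < x ->
  is_derive x 1 (fun y => p.[y] * ((1 + y) / 2) ^- L)
    ((quot_deriv L p).[x] * ((1 + x) / 2) ^- L.+1).
Proof.
move=> x1; have u0 : (1 + x) / 2 != 0 by apply/eqP; lra.
have uL0 : (u ^+ L).[x] != 0 by rewrite horner_exp horner_fair_bit expf_neq0.
have -> : (fun y => p.[y] * ((1 + y) / 2) ^- L) =
   (horner p * (fun y => ((u ^+ L).[y])^-1)).
  by apply/funext => y; rewrite fctE horner_exp horner_fair_bit.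
have := is_deriveM (is_derive_poly p x) (is_deriveV uL0 (is_derive_poly (u ^+ L) x)).
move=> /is_derive_eq; apply.
rewrite deriv_exp deriv_fair_bit /quot_deriv.
rewrite !(hornerM, hornerD, hornerN, hornerMn, hornerC, horner_exp, horner_fair_bit).
rewrite ?hornerZ.
rewrite /GRing.scale /= -[_ *+ L]mulr_natr.
case: L uL0 => [|L] _.
  by rewrite /= !expr0 expr1 invr1 !mulr0 mul0r mul0r subr0 add0r mul1r mulfK.
rewrite /= !exprS expr0 mulr1; have := expf_neq0 L u0.
set v := (1 + x) / 2 in u0 *; set w := v ^+ L => w0; field.
by rewrite u0 w0.
Qed.

(** Dividing by [u ^ L] commutes with differentiation up to the explicit
    operator [quot_deriv], which lowers the order of vanishing at 1 by at most
    one and maps [t ^ i * u ^ L] to [i * t ^ (i - 1) * u ^ L.+1]. *)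
Lemma derive1n_quot r L p c q (f : R -> R) :
    p = \sum_(i < r.+1) c i *: (t ^+ i * u ^+ L) + t ^+ r.+1 * q ->
    (forall y, -1 < y -> f y = p.[y] * ((1 + y) / 2) ^- L) ->
  derive1n r f 1 = r`!%:R * c r.
Proof.
elim: r L p c q f => [|r IH] L p c q f pE fE.
  rewrite derive1n0 fE; last by lra.
  rewrite pE big_ord1 expr0 mul1r expr1.
  rewrite hornerD hornerZ hornerM hornerD hornerX hornerN hornerC.
  rewrite horner_exp horner_fair_bit subrr mul0r addr0.
  rewrite (_ : (1 + 1) / 2 = 1 :> R); last by lra.
  by rewrite expr1n invr1 !mulr1 fact0 mul1r.
rewrite derive1Sn factS natrM [_%:R * _]mulrC -mulrA.
have [q' q'E] := quot_deriv_subX1M L r.+1 q.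
apply: (IH L.+1 (quot_deriv L p) (fun i => i.+1%:R * c i.+1) q').
  rewrite pE quot_derivD q'E; congr (_ + _).
  rewrite quot_deriv_sum big_ord_recl /= quot_derivZ quot_deriv_difference.
  rewrite scale0r scaler0 add0r; apply: eq_bigr => i _.
  by rewrite quot_derivZ quot_deriv_difference /bump /= add1n scalerA [_ * c _]mulrC.
move=> y y1; rewrite derive1E.
have [_ <-] := is_derive_quot L p y1.
apply: near_eq_derive; near=> z; apply: fE.
by near: z; exact: lt_nbhsr.
Unshelve. all: by end_near. Qed.

End TaylorCoefficients.

(** * Generating functions of binary digit sums *)

Section BinaryDigits.

Lemma sum_of_digitsE M i : (i < M)%N ->
  sum_of_digits i = (\sum_(j < M) odd (i %/ 2 ^ j))%N.
Proof.
move=> iM; rewrite /sum_of_digits -(big_mkord xpredT (fun j => odd (i %/ 2 ^ j) : nat)).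
rewrite -(big_mkord xpredT (fun j => odd (i %/ 2 ^ j) : nat)).
rewrite [RHS](big_cat_nat (n := i.+1)) //= [X in _ = (_ + X)%N]big1_seq ?addn0 //.
move=> j /=; rewrite mem_index_iota => /andP[ij _].
by rewrite divn_small // (leq_trans ij) // ltnW // ltn_expl.
Qed.

Lemma sum_of_digits_double i (b : bool) :
  sum_of_digits (b + i.*2)%N = (b + sum_of_digits i)%N.
Proof.
set M := (b + i.*2).+1.
have iM : (i < M)%N by rewrite /M; lia.
rewrite (@sum_of_digitsE M.+1) ?(@sum_of_digitsE M i) ?leqnSn //.
rewrite big_ord_recl /= expn0 divn1 oddD odd_double addbF oddb; congr (_ + _)%N.
apply: eq_bigr => j _; rewrite /bump /= add1n expnS divnMA.
by rewrite (_ : (b + i.*2) %/ 2 = i)%N //; lia.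
Qed.

Lemma sum_of_digits0 : sum_of_digits 0 = 0%N.
Proof. by rewrite /sum_of_digits big_ord1 div0n. Qed.

Lemma double_odd_ind (P : nat -> Prop) : P 0%N -> P 1%N ->
  (forall n (b : bool), (0 < n)%N -> P n -> P (b + n.*2)%N) -> forall n, P n.
Proof.
move=> P0 P1 PS; elim/ltn_ind => n IH.
case: (ltnP n 2) => [|n2]; first by case: n {IH} => [|[|]].
rewrite -[n]odd_double_half; apply: PS; first by lia.
by apply: IH; lia.
Qed.

Lemma floor_log2_double n (b : bool) : (0 < n)%N ->
  floor_log2 (b + n.*2) = (floor_log2 n).+1.
Proof.
by move=> n0; rewrite /floor_log2 trunc_log2S ?half_bit_double //; lia.
Qed.

Lemma floor_log2_1 : floor_log2 1 = 0%N. Proof. by []. Qed.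

Lemma sum_of_digits_le n : (0 < n)%N -> (sum_of_digits n <= (floor_log2 n).+1)%N.
Proof.
elim/double_odd_ind: n => [//||n b n0 IH _].
  by rewrite (sum_of_digits_double 0 true) sum_of_digits0.
rewrite sum_of_digits_double floor_log2_double //; have := IH n0.
by case: b; lia.
Qed.

Variable R : realType.
Local Notation u := (fair_bit R).

Definition digit_poly n : {poly R} := \sum_(i < n) 'X^(sum_of_digits i).

Lemma coef_digit_poly n k : (n%:R^-1 *: digit_poly n)`_k = prob_digits R n k.
Proof.
rewrite coefZ coef_sum /prob_digits mulrC; congr (_ / _).
rewrite -sum1_card natr_sum [RHS]big_mkcond /=.
by apply: eq_bigr => i _; rewrite coefXn eq_sym inE; case: eqP.
Qed.

Lemma horner_digit_poly n y : (n%:R^-1 *: digit_poly n).[y] = pgf_digits n y.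
Proof.
rewrite hornerZ horner_sum mulrC /pgf_digits; congr (_ / _).
by apply: eq_bigr => i _; rewrite hornerXn.
Qed.

Lemma fair_bit2 : 2 *: u = 1 + 'X.
Proof. by rewrite /fair_bit scalerA divff ?scale1r // pnatr_eq0. Qed.

(** Appending a binary digit to [i] multiplies the generating function of the
    digit sums by [1 + y]; the last number below an odd bound is alone. *)
Lemma digit_poly_double n (b : bool) :
  digit_poly (b + n.*2) = 2 *: u * digit_poly n + b%:R *: 'X^(sum_of_digits n).
Proof.
have E : digit_poly n.*2 = 2 *: u * digit_poly n.
  rewrite fair_bit2; elim: n => [|n IH].
    by rewrite /digit_poly !big_ord0 mulr0.
  rewrite doubleS /digit_poly !big_ord_recr /= -/(digit_poly _) IH.
  rewrite -/(digit_poly n) -[n.*2.+1]/((true + n.*2)%N) sum_of_digits_double.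
  rewrite -[n.*2]/((false + n.*2)%N) sum_of_digits_double add0n add1n exprS.
  by ring.
case: b; last by rewrite add0n scale0r addr0 E.
rewrite add1n /digit_poly big_ord_recr /= -/(digit_poly _) E scale1r.
by rewrite -[n.*2]/((false + n.*2)%N) sum_of_digits_double.
Qed.

(** One term for each bit of [n]: the numbers below [n] whose binary expansion
    first differs from that of [n] at this bit share their higher digits and
    have free lower digits. *)
Lemma digit_poly_expansion n : (0 < n)%N ->
  exists (a : nat -> nat) (b : nat -> bool), (forall d, (a d <= d)%N) /\
    digit_poly n = \sum_(d < (floor_log2 n).+1)
      ((b d)%:R * 2 ^+ (floor_log2 n - d)) *: ('X^(a d) * u ^+ (floor_log2 n - d)).
Proof.
elim/double_odd_ind: n => [//||n e n0 IH _].
  exists (fun=> 0%N), xpredT; split=> // ; rewrite floor_log2_1 big_ord1 /=.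
  by rewrite /digit_poly big_ord1 /= sum_of_digits0 !expr0 !mulr1 scale1r.
have [a [b [ad GE]]] := IH n0; set l := floor_log2 n in GE *.
exists (fun d => if (d <= l)%N then a d else if d == l.+1 then sum_of_digits n else 0)%N.
exists (fun d => if (d <= l)%N then b d else e); split.
  move=> d; case: ifP => // _; case: eqP => // ->; exact: sum_of_digits_le.
rewrite floor_log2_double // -/l big_ord_recr /= ltnn eqxx subnn !expr0 !mulr1.
rewrite digit_poly_double; congr (_ + _).
rewrite GE mulr_sumr; apply: eq_bigr => i _.
have il : (i <= l)%N by rewrite -ltnS.
by rewrite il subSn // !exprS -!mul_polyC !polyCM; ring.
Qed.

End BinaryDigits.

(** * Expansion of the digit generating function *)

Section ExpansionOfDigitPoly.
Variable R : realType.
Local Notation u := (fair_bit R).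
Local Notation t := ('X - 1 : {poly R}).

Lemma normalized_digit_poly_expansion n : (0 < n)%N ->
  exists (a : nat -> nat) (w : nat -> R),
    [/\ forall d, (a d <= d)%N,
        forall d, (d <= floor_log2 n)%N -> 0 <= w d <= 2 ^- d &
        n%:R^-1 *: digit_poly R n = \sum_(d < (floor_log2 n).+1)
          w d *: ('X^(a d) * u ^+ (floor_log2 n - d))].
Proof.
move=> n0; have [a [b [ad GE]]] := digit_poly_expansion R n0.
set l := floor_log2 n in GE *.
exists a, (fun d => (b d)%:R * 2 ^+ (l - d) / n%:R); split=> //; last first.
  by rewrite GE scaler_sumr; apply: eq_bigr => i _; rewrite scalerA mulrC.
move=> d dl; have n0' : 0 < n%:R :> R by rewrite ltr0n.
have p0 k : 0 < 2 ^+ k :> R by rewrite exprn_gt0.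
apply/andP; split; first by rewrite !mulr_ge0 ?invr_ge0 // ltW.
apply: le_trans (_ : 2 ^+ (l - d) / n%:R <= _).
  rewrite ler_wpM2r ?invr_ge0 // ?(ltW n0') //.
  by case: (b d); rewrite ?mul1r // mul0r ltW.
rewrite ler_pdivrMr // mulrC ler_pdivlMr // -exprD subnK //.
by rewrite -natrX ler_nat trunc_logP.
Qed.

Lemma normalized_pgfE n (y : R) :
  normalized_pgf n y =
  (n%:R^-1 *: digit_poly R n).[y] * ((1 + y) / 2) ^- floor_log2 n.
Proof. by rewrite /normalized_pgf horner_digit_poly. Qed.

Lemma sum_monomials_split r l (w : nat -> R) (a : nat -> nat) :
  \sum_(d < l.+1) w d *: ('X^(a d) * u ^+ (l - d)) =
  \sum_(i < r) (\sum_(d < l.+1) w d * taylor_coef R i (a d) d) *: (t ^+ i * u ^+ l)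
  + \sum_(d < l.+1) w d *: taylor_remainder R r (a d) d l.
Proof.
rewrite (eq_bigr (fun i : 'I_r => \sum_(d < l.+1)
    w d *: (taylor_coef R i (a d) d *: (t ^+ i * u ^+ l)))); last first.
  by move=> i _; rewrite scaler_suml; apply: eq_bigr => d _; rewrite scalerA.
rewrite exchange_big -big_split /=; apply: eq_bigr => d _.
by rewrite -scaler_sumr -scalerDr /taylor_remainder addrC subrK.
Qed.

Lemma expansion_coefE r n (a : nat -> nat) (w : nat -> R) :
  n%:R^-1 *: digit_poly R n = \sum_(d < (floor_log2 n).+1)
          w d *: ('X^(a d) * u ^+ (floor_log2 n - d)) ->
  expansion_coef R r n = \sum_(d < (floor_log2 n).+1) w d * taylor_coef R r (a d) d.
Proof.
set l := floor_log2 n; move=> GE.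
have [F FE] : exists F : nat -> {poly R}, forall d, (d < l.+1)%N ->
    taylor_remainder R r.+1 (a d) d l = t ^+ r.+1 * F d.
  have /choice[F FE] : forall d, exists q, (d < l.+1)%N ->
      taylor_remainder R r.+1 (a d) d l = t ^+ r.+1 * q.
    move=> d; case: (ltnP d l.+1) => [dl|_]; last by exists 0.
    have [q qE] := @taylor_remainder_dvd R r.+1 (a d) d l dl; exists q => _; exact: qE.
  by exists F.
rewrite /expansion_coef.
have pE : n%:R^-1 *: digit_poly R n =
    \sum_(i < r.+1) (\sum_(d < l.+1) w d * taylor_coef R i (a d) d) *: (t ^+ i * u ^+ l)
    + t ^+ r.+1 * \sum_(d < l.+1) w d *: F d.
  rewrite GE (sum_monomials_split r.+1); congr (_ + _).
  rewrite mulr_sumr; apply: eq_bigr => d _.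
  by rewrite (FE _ (ltn_ord d)) scalerAr.
rewrite (derive1n_quot (c := fun i => \sum_(d < l.+1) w d * taylor_coef R i (a d) d)
  pE (fun y _ => normalized_pgfE n y)).
by rewrite mulrC mulKf // pnatr_eq0 -lt0n fact_gt0.
Qed.

Lemma prob_digits_remainder n r (a : nat -> nat) (w : nat -> R) :
  n%:R^-1 *: digit_poly R n = \sum_(d < (floor_log2 n).+1)
          w d *: ('X^(a d) * u ^+ (floor_log2 n - d)) ->
  n%:R^-1 *: digit_poly R n
  - \sum_(i < r) expansion_coef R i n *: (t ^+ i * u ^+ floor_log2 n) =
  \sum_(d < (floor_log2 n).+1) w d *: taylor_remainder R r (a d) d (floor_log2 n).
Proof.
move=> GE; apply/eqP; rewrite subr_eq addrC; apply/eqP.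
under eq_bigr => i _ do rewrite (expansion_coefE i GE).
by rewrite -(sum_monomials_split r).
Qed.

Lemma coef_binomial l k : ((1 + 'X) ^+ l : {poly R})`_k = 'C(l, k)%:R.
Proof.
elim: l k => [|l IH] k; first by rewrite expr0 coef1 bin0n eq_sym.
rewrite exprS mulrDl mul1r coefD coefXM !IH.
by case: k => [|k]; rewrite /= ?bin0 ?addr0 // binS natrD.
Qed.

Lemma coef_difference r l k : (t ^+ r * u ^+ l)`_k =
  (-1) ^+ r * 2 ^- l * diff_binomial R r l k.
Proof.
have -> : t ^+ r * u ^+ l = ((-1) ^+ r * 2 ^- l) *:
   (\sum_(j < r.+1) ('C(r, j)%:R * (-1) ^+ j) *: ('X^j * (1 + 'X) ^+ l)).
  have -> : t = (-1) *: (1 - 'X) by rewrite scaleN1r opprB.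
  rewrite /fair_bit !exprZn -scalerAl -scalerAr scalerA exprVn; congr (_ *: _).
  rewrite exprBn mulr_suml; apply: eq_bigr => j _.
  rewrite expr1n mulr1 -[_ *+ 'C(_, _)]mulr_natl -mul_polyC polyCM polyC_natr.
  by rewrite polyC_exp polyCN polyC1; ring.
rewrite coefZ coef_sum /diff_binomial; congr (_ * _).
rewrite [RHS]big_mkcond /=; apply: eq_bigr => j _.
rewrite coefZ coefXnM ltnNge; case: leqP => //= jk; last by rewrite mulr0.
by rewrite coef_binomial.
Qed.

Lemma ffact_lower_bound d K : (d.+1 ^ K <= (d + K) ^_ K)%N.
Proof.
elim: K => [|K IH]; first by rewrite ffactn0.
by rewrite addnS ffactSS expnS leq_mul // ltnS leq_addr.
Qed.

(** Partial sums of the power series of [(1 - x) ^ - (K + 1)] at [x = 1 / 2]; Pascal's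
    rule replaces [K + 1] by [K] at the price of a factor 2. *)
Lemma sum_bin_half K L : \sum_(d < L) 2 ^- d * 'C(d + K, K)%:R <= 2 ^+ K.+1 :> R.
Proof.
elim: K L => [|K IHK].
  move=> L; under eq_bigr => d _ do rewrite bin0 mulr1.
  suff : \sum_(i < L) 2 ^- i = 2 - 2 * 2 ^- L :> R.
    move=> ->; rewrite expr1 lerBlDr lerDl mulr_ge0 // invr_ge0 exprn_ge0 //.
  elim: L => [|L IH]; first by rewrite big_ord0 expr0; lra.
  by rewrite big_ord_recr /= IH exprS invfM; lra.
have rec L : \sum_(d < L.+1) 2 ^- d * 'C(d + K.+1, K.+1)%:R =
   \sum_(d < L.+1) 2 ^- d * 'C(d + K, K)%:R +
   2^-1 * \sum_(d < L) 2 ^- d * 'C(d + K.+1, K.+1)%:R :> R.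
  rewrite mulr_sumr !(big_ord_recl L) /= !add0n !binn -addrA; congr (_ + _).
  rewrite -big_split /=; apply: eq_bigr => d _; rewrite /bump /= !add1n.
  by rewrite !addSn !addnS binS natrD exprS invfM; ring.
elim=> [|L IH]; first by rewrite big_ord0 exprn_ge0.
rewrite rec exprS; move: (IHK L.+1) IH; rewrite [2 ^+ K.+2]exprS; lra.
Qed.

Lemma sum_geometric_power K : exists2 C : R, 0 <= C &
  forall L, \sum_(d < L) 2 ^- d * d.+1%:R ^+ K <= C.
Proof.
exists (K`!%:R * 2 ^+ K.+1); first by rewrite mulr_ge0 ?exprn_ge0.
move=> L; apply: le_trans (_ : K`!%:R * \sum_(d < L) 2 ^- d * 'C(d + K, K)%:R <= _).
  rewrite mulr_sumr; apply: ler_sum => d _.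
  rewrite mulrCA ler_wpM2l ?invr_ge0 ?exprn_ge0 // -natrX -natrM ler_nat.
  by rewrite mulnC bin_ffact ffact_lower_bound.
by rewrite ler_wpM2l ?sum_bin_half.
Qed.

Lemma expansion_coef_bounded r : exists2 C : R, 0 <= C &
  forall n, (0 < n)%N -> `|expansion_coef R r n| <= C.
Proof.
have [C C0 HC] := sum_geometric_power r.
exists (2 ^+ r * C); first by rewrite mulr_ge0 ?exprn_ge0.
move=> n n0; have [a [w [ad wd GE]]] := normalized_digit_poly_expansion n0.
rewrite (expansion_coefE r GE); apply: le_trans (ler_norm_sum _ _ _) _.
apply: (@le_trans _ _
  (2 ^+ r * \sum_(d < (floor_log2 n).+1) 2 ^- d * d.+1%:R ^+ r)); last first.
  by rewrite ler_wpM2l ?exprn_ge0.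
rewrite mulr_sumr; apply: ler_sum => d _.
have /andP[w0 w2] := wd d (ltn_ord d).
rewrite normrM (ger0_norm w0) mulrCA -exprMn; apply: ler_pM => //.
apply: le_trans (taylor_coef_bound R r (ad d) (leqnn d)) _.
by rewrite lerXn2r ?nnegrE ?mulr_ge0 // -natrM ler_nat leq_mul.
Qed.

End ExpansionOfDigitPoly.

(** * The standardized binomial distribution *)

Section StandardizedBinomial.
Variable R : realType.
Implicit Types (f g W : R -> R) (x y : R).

Definition std_point (N k : nat) : R := (2 * k%:R - N%:R) / Num.sqrt N%:R.

Definition binomial_mean (N : nat) f : R :=
  \sum_(k < N.+1) 2 ^- N * 'C(N, k)%:R * f (std_point N k).

Lemma sum_binS N (g : nat -> R) :
  \sum_(k < N.+2) 'C(N.+1, k)%:R * g k =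
  \sum_(j < N.+1) 'C(N, j)%:R * (g j + g j.+1).
Proof.
rewrite big_ord_recl /= bin0.
under eq_bigr => k _ do rewrite /bump /= add1n binS natrD mulrDl.
rewrite big_split /= addrA big_ord_recr /= bin_small // mul0r addr0.
under [RHS]eq_bigr => k _ do rewrite mulrDr.
rewrite [RHS]big_split /=; congr (_ + _).
rewrite [RHS]big_ord_recl /= bin0; congr (_ + _).
Qed.

(** Summation by parts: [k * 'C(N + 1, k)] and [(N + 1 - k) * 'C(N + 1, k)] are both
    [N + 1] times a binomial coefficient of index [N]. *)
Lemma sum_binS_stein N (g : nat -> R) :
  \sum_(k < N.+2) 'C(N.+1, k)%:R * ((2 * k%:R - N.+1%:R) * g k) =
  N.+1%:R * \sum_(j < N.+1) 'C(N, j)%:R * (g j.+1 - g j).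
Proof.
have up : \sum_(k < N.+2) 'C(N.+1, k)%:R * (k%:R * g k) =
    N.+1%:R * \sum_(j < N.+1) 'C(N, j)%:R * g j.+1.
  rewrite big_ord_recl /= mul0r mulr0 add0r mulr_sumr.
  apply: eq_bigr => j _; rewrite /bump /= add1n !mulrA; congr (_ * _).
  by rewrite -!natrM mul_bin_diag mulnC.
have down : \sum_(k < N.+2) 'C(N.+1, k)%:R * ((N.+1%:R - k%:R) * g k) =
    N.+1%:R * \sum_(j < N.+1) 'C(N, j)%:R * g j.
  rewrite big_ord_recr /= subrr mul0r mulr0 addr0 mulr_sumr.
  apply: eq_bigr => j _; rewrite !mulrA; congr (_ * _).
  rewrite -natrB; last by rewrite ltnW // ltn_ord.
  by rewrite -!natrM mulnC -mul_bin_down.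
under [X in _ = _ * X]eq_bigr => j _ do rewrite mulrBr.
rewrite sumrB mulrBr -up -down -sumrB; apply: eq_bigr => k _; ring.
Qed.

Lemma std_pointS N j :
  std_point N j.+1 - std_point N j = 2 / Num.sqrt N%:R.
Proof.
by rewrite /std_point -mulrBl -[j.+1%:R]natr1; congr (_ / _); ring.
Qed.

Lemma binomial_meanS N f : binomial_mean N.+1 f =
  2^-1 * \sum_(j < N.+1) 2 ^- N * 'C(N, j)%:R *
    (f (std_point N.+1 j) + f (std_point N.+1 j.+1)).
Proof.
rewrite /binomial_mean.
under eq_bigr => k _ do rewrite -mulrA.
under [in RHS]eq_bigr => k _ do rewrite -mulrA.
rewrite -!mulr_sumr (sum_binS N (fun k => f (std_point N.+1 k))) exprS invfM.
by rewrite mulrA.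
Qed.

Lemma sqrt_natS_gt0 N : 0 < Num.sqrt N.+1%:R :> R.
Proof. by rewrite sqrtr_gt0 ltr0n. Qed.

Lemma binomial_mean_stein N f : binomial_mean N.+1 (fun x => x * f x) =
  2^-1 * \sum_(j < N.+1) 2 ^- N * 'C(N, j)%:R *
    (Num.sqrt N.+1%:R * (f (std_point N.+1 j.+1) - f (std_point N.+1 j))).
Proof.
have s0 := sqrt_natS_gt0 N; set s := Num.sqrt _ in s0 *.
have sE : s ^+ 2 = N.+1%:R by rewrite sqr_sqrtr.
transitivity (2 ^- N.+1 * s^-1 * \sum_(k < N.+2) 'C(N.+1, k)%:R *
    ((2 * k%:R - N.+1%:R) * f (std_point N.+1 k))).
  rewrite mulr_sumr; apply: eq_bigr => k _; rewrite /std_point -/s; ring.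
rewrite (sum_binS_stein N (fun k => f (std_point N.+1 k))) -sE !mulr_sumr.
apply: eq_bigr => j _; rewrite exprS; field.
by rewrite expf_neq0 ?pnatr_eq0 // gt_eqF.
Qed.

Lemma le_binomial_mean N f g : (forall x, f x <= g x) ->
  binomial_mean N f <= binomial_mean N g.
Proof.
move=> fg; apply: ler_sum => k _; rewrite ler_wpM2l // mulr_ge0 //.
Qed.

Lemma binomial_meanD N f g :
  binomial_mean N (fun x => f x + g x) = binomial_mean N f + binomial_mean N g.
Proof. by rewrite -big_split; apply: eq_bigr => k _; rewrite mulrDr. Qed.

Lemma binomial_meanZ N c f :
  binomial_mean N (fun x => c * f x) = c * binomial_mean N f.
Proof. by rewrite mulr_sumr; apply: eq_bigr => k _; ring. Qed.

Lemma binomial_mean_cst N c : binomial_mean N (fun=> c) = c.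
Proof.
rewrite /binomial_mean -mulr_suml -mulr_sumr -natr_sum.
have -> : (\sum_(i < N.+1) 'C(N, i) = 2 ^ N)%N.
  by rewrite -[2%N]/(1 + 1)%N expnDn; apply: eq_bigr => i _; rewrite !exp1n !muln1.
by rewrite natrX mulVf ?mul1r // expf_neq0 ?pnatr_eq0.
Qed.

(** A fair coin is flipped [N + 1] times; comparing the walk before and after
    one flip turns [x * f x] into a symmetric difference quotient of [f], and
    the trapezoidal rule turns the latter into [f']. *)
Lemma binomial_mean_stein_bound N f f' W :
  (forall x y, x < y ->
     `|f y - f x - (y - x) * (f' x + f' y) / 2| <= (y - x) ^+ 2 * (W x + W y)) ->
  `|binomial_mean N.+1 (fun x => x * f x - f' x)| <=
    4 / Num.sqrt N.+1%:R * binomial_mean N.+1 W.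
Proof.
move=> fW; have s0 := sqrt_natS_gt0 N.
have -> : binomial_mean N.+1 (fun x => x * f x - f' x) =
    binomial_mean N.+1 (fun x => x * f x) + -1 * binomial_mean N.+1 f'.
  rewrite -binomial_meanZ -binomial_meanD; apply: eq_bigr => k _; ring.
rewrite binomial_mean_stein !binomial_meanS mulrCA -mulrDr.
rewrite mulr_sumr -big_split /= normrM ger0_norm ?invr_ge0 // mulrCA.
rewrite ler_wpM2l ?invr_ge0 // mulr_sumr.
apply: le_trans (ler_norm_sum _ _ _) _; apply: ler_sum => j _.
have := fW (std_point N.+1 j) (std_point N.+1 j.+1).
rewrite -subr_gt0 std_pointS // divr_gt0 // => /(_ isT).
set s := Num.sqrt _ in s0 *; set x := std_point N.+1 j; set y := std_point N.+1 j.+1.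
set p := _ * 'C(_, _)%:R => H.
have p0 : 0 <= p by rewrite mulr_ge0 ?invr_ge0 ?exprn_ge0.
have -> : p * (s * (f y - f x)) + -1 * (p * (f' x + f' y)) =
   p * s * (f y - f x - 2 / s * (f' x + f' y) / 2).
  by field; rewrite gt_eqF.
have -> : 4 / s * (p * (W x + W y)) = p * s * ((2 / s) ^+ 2 * (W x + W y)).
  by field; rewrite gt_eqF.
have ps : 0 <= p * s by rewrite mulr_ge0 // ltW.
by rewrite normrM ger0_norm // ler_wpM2l.
Qed.

Lemma odd_power_increment j x y : x < y ->
  y ^+ (2 * j).+1 - x ^+ (2 * j).+1 <=
  (2 * j).+1%:R * ((y - x) * (x ^+ (2 * j) + y ^+ (2 * j))).
Proof.
move=> xy; rewrite subrXX mulrCA ler_wpM2l ?subr_ge0 ?(ltW xy) //.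
rewrite -[X in X%:R * _]card_ord -sum1_card natr_sum mulr_suml.
apply: ler_sum => i _; rewrite mul1r; apply: le_trans (ler_norm _) _.
have e (z : R) : z ^+ (2 * j) = `|z| ^+ (2 * j).
  have z0 : 0 <= z ^+ (2 * j) by rewrite exprM; apply: exprn_ge0; apply: sqr_ge0.
  by rewrite -normrX ger0_norm.
rewrite (e x) (e y) normrM !normrX.
have iE : (2 * j = ((2 * j).+1.-1 - i) + i)%N by have := ltn_ord i; lia.
case: (lerP `|x| `|y|) => [xy'|/ltW yx'].
  apply: le_trans (_ : `|y| ^+ (2 * j) <= _); last first.
    by rewrite lerDr exprn_ge0.
  rewrite [X in _ <= _ ^+ X]iE exprD ler_wpM2l ?exprn_ge0 //.
  by rewrite lerXn2r ?nnegrE.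
apply: le_trans (_ : `|x| ^+ (2 * j) <= _); last first.
  by rewrite lerDl exprn_ge0.
rewrite [X in _ <= _ ^+ X]iE exprD ler_wpM2r ?exprn_ge0 //.
by rewrite lerXn2r ?nnegrE.
Qed.

(** Stein's identity for [x ^ (2 j + 1)] bounds the moment of order [2 j + 2] by a
    multiple of that of order [2 j]. *)
Lemma even_moment_bounded j : exists2 C : R, 0 <= C &
  forall N, binomial_mean N.+1 (fun x => x ^+ (2 * j)) <= C.
Proof.
elim: j => [|j [C C0 HC]].
  exists 1 => // N; rewrite (_ : binomial_mean _ _ = 1) //.
  by rewrite -[RHS](binomial_mean_cst N.+1); apply: eq_bigr => k _; rewrite expr0.
exists (2 * (2 * j).+1%:R * C) => [|N]; first by rewrite !mulr_ge0.
apply: (@le_trans _ _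
  (2 * (2 * j).+1%:R * binomial_mean N.+1 (fun x => x ^+ (2 * j)))); last first.
  by rewrite ler_wpM2l ?mulr_ge0.
have -> : binomial_mean N.+1 (fun x => x ^+ (2 * j.+1)) =
   binomial_mean N.+1 (fun x => x * x ^+ (2 * j).+1).
  by apply: eq_bigr => k _; rewrite -exprS mulnS.
rewrite binomial_mean_stein binomial_meanS mulrCA.
rewrite ler_wpM2l ?invr_ge0 // mulr_sumr; apply: ler_sum => k _.
rewrite [leRHS]mulrCA ler_wpM2l ?mulr_ge0 ?invr_ge0 ?exprn_ge0 //.
have s0 := sqrt_natS_gt0 N.
have := @odd_power_increment j (std_point N.+1 k) (std_point N.+1 k.+1).
rewrite -subr_gt0 std_pointS // divr_gt0 // => /(_ isT) H.
rewrite -ler_pdivlMl //; apply: le_trans H _.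
by rewrite le_eqVlt; apply/orP; left; apply/eqP; field; rewrite gt_eqF.
Qed.

(** A gauge of polynomial growth which is monotone in [`|x|] and at least 1. *)
Definition weight (K : nat) x : R := (1 + x ^+ 2) ^+ K.

Lemma weight_ge1 K x : 1 <= weight K x.
Proof. by rewrite exprn_ege1 // lerDl sqr_ge0. Qed.

Lemma weight_ge0 K x : 0 <= weight K x.
Proof. exact: le_trans (weight_ge1 K x). Qed.

Lemma le_weight K K' x : (K <= K')%N -> weight K x <= weight K' x.
Proof. by move=> KK'; rewrite ler_weXn2l // lerDl sqr_ge0. Qed.

Lemma norm_le_weight1 x : `|x| <= weight 1 x.
Proof.
rewrite /weight expr1 -[x ^+ 2]real_normK ?num_real //.
by have := sqr_ge0 (`|x| - 1); rewrite sqrrB1; have := normr_ge0 x; lra.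
Qed.

Lemma weightD K K' x : weight (K + K') x = weight K x * weight K' x.
Proof. exact: exprD. Qed.

Lemma weight_le_power K x : weight K x <= 2 ^+ K * (1 + x ^+ (2 * K)).
Proof.
rewrite exprM /weight; have := sqr_ge0 x; set z := x ^+ 2 => z0.
have [z1|/ltW z1] := lerP z 1.
  apply: le_trans (_ : 2 ^+ K * 1 <= _); last first.
    by rewrite ler_wpM2l ?exprn_ge0 // lerDl exprn_ge0.
  by rewrite mulr1 lerXn2r ?nnegrE; lra.
apply: le_trans (_ : 2 ^+ K * z ^+ K <= _); last first.
  by rewrite ler_wpM2l ?exprn_ge0 // lerDr.
by rewrite -exprMn lerXn2r ?nnegrE; lra.
Qed.

Lemma weight_mean_bounded K : exists2 C : R, 0 <= C &
  forall N, binomial_mean N.+1 (weight K) <= C.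
Proof.
have [C C0 HC] := even_moment_bounded K.
exists (2 ^+ K * (1 + C)) => [|N]; first by rewrite mulr_ge0 ?exprn_ge0 ?addr_ge0.
apply: le_trans (le_binomial_mean _ (weight_le_power K)) _.
rewrite binomial_meanZ binomial_meanD binomial_mean_cst.
by rewrite ler_wpM2l ?exprn_ge0 // lerD2l.
Qed.

End StandardizedBinomial.

(** * The Gaussian function *)

Section Gaussian.
Variable R : realType.
Implicit Types (f : R -> R) (x : R).

Definition gauss x : R := expR (- (x ^+ 2 / 2)).

Lemma gauss_ge0 x : 0 <= gauss x. Proof. exact: expR_ge0. Qed.

Lemma is_derive_gauss x : is_derive x 1 gauss (- x * gauss x).
Proof.
have -> : gauss = expR \o horner (- 2^-1 *: 'X^2).
  by apply/funext => z; rewrite /gauss /= hornerZ hornerXn; congr expR; ring.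
apply: is_derive_eq.
rewrite derivZ derivXn hornerZ hornerMn /= hornerX hornerZ hornerXn.
by rewrite mulrC; congr (_ * _); field.
Qed.

Lemma continuous_of_derive f f' : (forall x, is_derive x 1 f (f' x)) -> continuous f.
Proof.
move=> H x; apply/differentiable_continuous/derivable1_diffP.
by case: (H x).
Qed.

Lemma continuous_gauss : continuous gauss.
Proof. exact: continuous_of_derive is_derive_gauss. Qed.

End Gaussian.

(** * Krawtchouk and Hermite polynomials *)

Section KrawtchoukHermite.
Variable R : realType.
Local Notation t := ('X - 1 : {poly R}).
Local Notation w := (1 + 'X : {poly R}).

Lemma two_step_ind (P : nat -> Prop) :
  P 0%N -> P 1%N -> (forall m, P m -> P m.+1 -> P m.+2) -> forall m, P m.
Proof.
move=> P0 P1 PS m; suff: P m /\ P m.+1 by case.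
by elim: m => [//|m [Pm Pm1]]; split=> //; exact: PS.
Qed.

(** Krawtchouk polynomials, normalized so that they tend to the Hermite
    polynomials when [N] grows. *)
Fixpoint kraw (N x : R) (m : nat) {struct m} : R :=
  match m with
  | 0 => 1
  | m1.+1 => match m1 with
             | 0 => x
             | m2.+1 => (x * kraw N x m1 - m1%:R * kraw N x m2) / (1 - m1%:R / N)
             end
  end.

Lemma krawSS N x m :
  kraw N x m.+2 = (x * kraw N x m.+1 - m.+1%:R * kraw N x m) / (1 - m.+1%:R / N).
Proof. by []. Qed.

Fixpoint hermite_poly (m : nat) {struct m} : {poly R} :=
  match m with
  | 0 => 1
  | m1.+1 => match m1 with
             | 0 => 'X
             | m2.+1 => 'X * hermite_poly m1 - m1%:R *: hermite_poly m2
             end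
  end.

Lemma hermite_polySS m :
  hermite_poly m.+2 = 'X * hermite_poly m.+1 - m.+1%:R *: hermite_poly m.
Proof. by []. Qed.

Lemma deriv_hermite_poly m : (hermite_poly m.+1)^`() = m.+1%:R *: hermite_poly m.
Proof.
elim/two_step_ind: m => [||m IH1 IH2]; first by rewrite /= derivX scale1r.
  by rewrite /= derivB derivM derivX derivZ (derivC 1) scaler0 subr0 mul1r mulr1 scaler_nat.
rewrite hermite_polySS derivB derivM derivX derivZ IH1 IH2 mul1r.
rewrite !hermite_polySS -!mul_polyC -[m.+3%:R]natr1 -[m.+2%:R]natr1.
by rewrite !polyCD polyC1; ring.
Qed.

Lemma hermite_polyS m : hermite_poly m.+1 = 'X * hermite_poly m - (hermite_poly m)^`().
Proof.
case: m => [|m]; first by rewrite /= mulr1 (derivC 1) subr0.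
by rewrite deriv_hermite_poly.
Qed.

(** With [Q = t ^ m * w ^ M], where [2 * 'X = w + t], the polynomial
    [(m + M) * Q - 2 * 'X * Q'] loses one factor [t] or [w] in each of its terms. *)
Lemma krawtchouk_coef_rec m M k :
  (2 * k%:R - (m + M)%:R) * (t ^+ m * w ^+ M)`_k =
  m%:R * (t ^+ m.-1 * w ^+ M.+1)`_k + M%:R * (t ^+ m.+1 * w ^+ M.-1)`_k.
Proof.
have E : 2 *: ('X * (t ^+ m * w ^+ M)^`()) - (m + M)%:R *: (t ^+ m * w ^+ M) =
    m%:R *: (t ^+ m.-1 * w ^+ M.+1) + M%:R *: (t ^+ m.+1 * w ^+ M.-1).
  rewrite derivM !deriv_exp derivB derivD derivX (derivC 1) subr0 add0r.
  rewrite -[_ *+ m]mulr_natl -[_ *+ M]mulr_natl -!mul_polyC !polyC_natr.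
  case: m M => [|m] [|M]; rewrite /= ?exprS ?expr0 ?mulr0n ?natrD -?[_.+1%:R]natr1; ring.
move: (congr1 (fun p : {poly R} => p`_k) E).
rewrite !coefD coefN !coefZ coefXM => <-.
case: k => [|k] /=; first by ring.
by rewrite coef_deriv -mulr_natl; ring.
Qed.

Lemma krawtchouk_coefE m M k : (0 < m + M)%N ->
  (t ^+ m * w ^+ M)`_k = 'C(m + M, k)%:R * Num.sqrt (m + M)%:R ^- m *
     kraw (m + M)%:R (std_point R (m + M) k) m.
Proof.
suff H N : (0 < N)%N -> (m <= N)%N ->
  (t ^+ m * w ^+ (N - m))`_k =
    'C(N, k)%:R * Num.sqrt N%:R ^- m * kraw N%:R (std_point R N k) m.
  by move=> N0; have := H _ N0 (leq_addr _ _); rewrite addKn.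
case: N => // N _; set s := Num.sqrt N.+1%:R.
have s0 : 0 < s by apply: sqrt_natS_gt0.
have sE : s ^+ 2 = N.+1%:R by rewrite sqr_sqrtr.
have N0 : N.+1%:R != 0 :> R by rewrite pnatr_eq0.
elim/two_step_ind: m => [||m IH1 IH2] mN.
- by rewrite expr0 mul1r subn0 coef_binomial invr1 !mulr1.
- have := krawtchouk_coef_rec 0 N.+1 k; rewrite mul0r !add0r expr0 mul1r coef_binomial.
  rewrite subn1 /= expr1 /std_point -/s => E.
  apply: (mulfI N0); rewrite -E -sE; field; rewrite gt_eqF //.
- have /IH1 E1 : (m <= N.+1)%N by lia.
  have /IH2 E2 : (m.+1 <= N.+1)%N by lia.
  have := krawtchouk_coef_rec m.+1 (N.+1 - m.+1) k.
  rewrite (_ : (m.+1 + (N.+1 - m.+1) = N.+1)%N); last by lia.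
  rewrite (_ : ((N.+1 - m.+1).+1 = N.+1 - m)%N); last by lia.
  rewrite (_ : ((N.+1 - m.+1).-1 = N.+1 - m.+2)%N); last by lia.
  rewrite E1 E2 krawSS natrB; last by lia.
  set q := (_ * _ : {poly R})`_k; rewrite /std_point -/s; set a := 2 * _ - _.
  set A := kraw _ _ m.+1; set B := kraw _ _ m; set c := 'C(_, _)%:R.
  have d0 : s ^+ 2 - m.+1%:R != 0 by rewrite sE subr_eq0 eqr_nat; lia.
  rewrite -sE => E.
  apply: (mulfI d0); have {E} -> : (s ^+ 2 - m.+1%:R) * q =
     a * (c / s ^+ m.+1 * A) - m.+1%:R * (c / s ^+ m * B) by rewrite E /=; ring.
  rewrite !exprS; field.
have -> : s * s - (1 + m%:R) != 0 by rewrite -expr2 [1 + _]addrC natr1.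
  by rewrite expf_neq0 ?gt_eqF.
Qed.

(** As long as [m + 2 <= N], the denominators in the recurrence are at least
    [1 / (m + 2)], so the bound does not deteriorate with [N]. *)
Lemma kraw_bounded m : exists2 C : R, 0 <= C &
  forall (N : nat) x, (0 < N)%N -> (m <= N)%N ->
    `|kraw N%:R x m| <= C * weight m x.
Proof.
elim/two_step_ind: m => [||m [C1 C10 H1] [C2 C20 H2]].
- by exists 1 => // N x _ _; rewrite normr1 /weight expr0 mulr1.
- by exists 1 => // N x _ _; rewrite mul1r norm_le_weight1.
exists (m.+2%:R * (C2 + m.+1%:R * C1)).
  by rewrite mulr_ge0 // addr_ge0 // mulr_ge0.
move=> N x N0 mN; rewrite krawSS.
have d0 : m.+2%:R^-1 <= 1 - m.+1%:R / N%:R :> R.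
  have N0' : 0 < N%:R :> R by rewrite ltr0n.
  rewrite lerBrDr -[leRHS](_ : m.+2%:R^-1 + m.+1%:R / m.+2%:R = 1); last first.
    by rewrite -[X in X + _]mul1r -mulrDl nat1r divff // pnatr_eq0.
  by rewrite lerD2l ler_pM2l ?ltr0n // lef_pV2 ?posrE ?ltr0n // ler_nat.
have d1 : 0 < 1 - m.+1%:R / N%:R :> R by apply: lt_le_trans d0; rewrite invr_gt0.
rewrite normrM normfV (gtr0_norm d1) ler_pdivrMr // -mulrA.
apply: le_trans (_ : (C2 + m.+1%:R * C1) * weight m.+2 x <= _); last first.
  set z := _ * weight _ _.
  have z0 : 0 <= z by rewrite mulr_ge0 ?weight_ge0 ?addr_ge0 ?mulr_ge0.
  rewrite mulrAC ler_peMl // -ler_pdivrMl ?ltr0n // mulr1 //.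
apply: le_trans (ler_normB _ _) _; rewrite !normrM normr_nat mulrDl.
apply: lerD; last first.
  rewrite -mulrA ler_wpM2l //; apply: le_trans (H1 N x N0 _) _; first by lia.
  by rewrite ler_wpM2l // le_weight //; lia.
rewrite -[m.+2]add1n weightD mulrCA; apply: ler_pM => //.
  exact: norm_le_weight1.
by apply: H2 => //; lia.
Qed.

(** Subtracting the two recurrences leaves the defect [(m + 1) / N] times a bounded
    Krawtchouk polynomial. *)
Lemma kraw_near_hermite m : exists2 C : R, 0 <= C &
  forall (N : nat) x, (0 < N)%N -> (m <= N)%N ->
    `|kraw N%:R x m - (hermite_poly m).[x]| <= C / N%:R * weight m x.
Proof.
elim/two_step_ind: m => [||m [C1 C10 H1] [C2 C20 H2]].
- by exists 0 => // N x _ _; rewrite /= hornerC subrr normr0 !mul0r.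
- by exists 0 => // N x _ _; rewrite /= hornerX subrr normr0 !mul0r.
have [B B0 HB] := kraw_bounded m.+2.
exists (C2 + m.+1%:R * C1 + m.+1%:R * B).
  by rewrite !addr_ge0 // mulr_ge0.
move=> N x N0 mN; have N0' : 0 < N%:R :> R by rewrite ltr0n.
have d0 : 1 - m.+1%:R / N%:R != 0 :> R.
  have -> : 1 - m.+1%:R / N%:R = (N%:R - m.+1%:R) / N%:R :> R by field; rewrite gt_eqF.
  by rewrite mulf_neq0 ?invr_neq0 ?gt_eqF // subr_gt0 ltr_nat.
have -> : kraw N%:R x m.+2 - (hermite_poly m.+2).[x] =
    x * (kraw N%:R x m.+1 - (hermite_poly m.+1).[x])
    - m.+1%:R * (kraw N%:R x m - (hermite_poly m).[x])
    + m.+1%:R / N%:R * kraw N%:R x m.+2.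
  have E : (1 - m.+1%:R / N%:R) * kraw N%:R x m.+2 =
     x * kraw N%:R x m.+1 - m.+1%:R * kraw N%:R x m by rewrite krawSS mulrC divfK.
  rewrite hermite_polySS hornerD hornerN hornerZ hornerM hornerX.
  move: E; set K := kraw _ _ m.+2; set a := m.+1%:R / _.
  rewrite mulrBl mul1r => /eqP; rewrite subr_eq => /eqP E; rewrite [X in X - _ = _]E; ring.
apply: le_trans (ler_normD _ _) _; rewrite [leRHS](_ : _ =
   C2 / N%:R * weight m.+2 x + m.+1%:R * (C1 / N%:R * weight m.+2 x)
   + m.+1%:R / N%:R * (B * weight m.+2 x)); last by ring.
apply: lerD; last first.
  rewrite normrM ger0_norm ?divr_ge0 // ler_wpM2l ?divr_ge0 //; exact: HB.
apply: le_trans (ler_normB _ _) _; rewrite !normrM normr_nat.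
have q0 C : 0 <= C -> 0 <= C / N%:R by move=> C0; rewrite divr_ge0.
apply: lerD; last first.
  rewrite ler_wpM2l //; apply: le_trans (H1 N x N0 _) _; first by lia.
  by rewrite ler_wpM2l ?q0 // le_weight //; lia.
rewrite -[m.+2]add1n weightD mulrCA; apply: ler_pM => //.
  exact: norm_le_weight1.
by apply: H2 => //; lia.
Qed.

(** Differentiating [p.[x] * exp (- x ^ 2 / 2)] acts on [p] as [p |-> p' - x p], which
    is the Hermite recurrence up to sign. *)
Lemma hermiteE m x : hermite m x = (hermite_poly m).[x] :> R.
Proof.
rewrite /hermite; set g := (fun t : R => expR (- (t ^+ 2 / 2))) : R -> R.
have dg (y : R) : is_derive y 1 g (- y * g y) by exact: is_derive_gauss.
have E k : derive1n k g = (fun y => (-1) ^+ k * (hermite_poly k).[y] * g y).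
  elim: k => [|k IH]; first by apply/funext => y; rewrite /= expr0 hornerC !mul1r.
  apply/funext => y; rewrite derive1nS IH derive1E.
  have -> : (fun y => (-1) ^+ k * (hermite_poly k).[y] * g y) =
     horner ((-1) ^+ k *: hermite_poly k) * g.
    by apply/funext => z; rewrite fctE hornerZ.
  have := is_deriveM (is_derive_poly ((-1) ^+ k *: hermite_poly k) y) (dg y).
  move=> [_ ->]; rewrite hermite_polyS hornerD hornerN hornerM hornerX derivZ !hornerZ.
  by rewrite /GRing.scale /= exprS; ring.
rewrite E /= /g.
have -> : (-1) ^+ m * expR (x ^+ 2 / 2) * ((-1) ^+ m * (hermite_poly m).[x] *
   expR (- (x ^+ 2 / 2))) = ((-1) ^+ m * (-1) ^+ m) * (hermite_poly m).[x] *
   (expR (x ^+ 2 / 2) * expR (- (x ^+ 2 / 2))) by ring.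
by rewrite -expRD subrr expR0 mulr1 -expr2 sqrr_sign mul1r.
Qed.

End KrawtchoukHermite.

(** * Gaussian tails *)

Section GaussianStein.
Variable R : realType.
Implicit Types (h f : R -> R) (x y : R).
Local Notation mu := (@lebesgue_measure R).

Lemma weight_gauss_le K : exists2 C : R, 0 <= C &
  forall x, weight K x * gauss x <= C * expR (- (x ^+ 2 / 4)).
Proof.
exists ((4 * K.+1%:R) ^+ K); first by rewrite exprn_ge0 // mulr_ge0.
move=> x; rewrite /weight /gauss; have := sqr_ge0 x; set z := x ^+ 2 => z0.
have k0 : 0 < 4 * K.+1%:R :> R by rewrite mulr_gt0.
have k1 : 1 <= K.+1%:R :> R by rewrite ler1n.
rewrite (_ : - (z / 4) = z / 4 - z / 2); last by field.
rewrite expRD mulrA ler_wpM2r ?expR_ge0 //.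
have H : 1 + z <= (4 * K.+1%:R) * expR (z / (4 * K.+1%:R)).
  apply: le_trans (_ : (4 * K.+1%:R) * (1 + z / (4 * K.+1%:R)) <= _).
    by rewrite mulrDr mulr1 mulrCA mulfV ?gt_eqF // mulr1; lra.
  by rewrite ler_wpM2l ?expR_ge1Dx // ltW.
apply: le_trans (_ : ((4 * K.+1%:R) * expR (z / (4 * K.+1%:R))) ^+ K <= _).
  apply: lerXn2r => //; rewrite nnegrE; first exact: addr_ge0.
  by apply: mulr_ge0; [exact: ltW|exact: expR_ge0].
rewrite exprMn ler_wpM2l ?exprn_ge0 ?(ltW k0) //.
rewrite -expRM_natl ler_expR.
rewrite (_ : K%:R * (z / (4 * K.+1%:R)) = z / 4 * (K%:R / K.+1%:R)); last first.
  by field; rewrite addrC natr1 pnatr_eq0.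
rewrite ler_piMr ?divr_ge0 // ler_pdivrMr ?ltr0n // mul1r ler_nat //.
Qed.

Lemma integrable_wide_gauss :
  mu.-integrable setT (EFin \o (fun x => expR (- (x ^+ 2 / 4)))).
Proof.
have s0 : Num.sqrt 2 != 0 :> R by rewrite gt_eqF // sqrtr_gt0.
have := integrableZl (measurableT) (normal_peak (Num.sqrt (2:R)))^-1
  (integrable_normal_pdf (0 : R) (Num.sqrt 2)).
apply: eq_integrable => // x _.
rewrite /= normal_pdfE // -EFinM mulKf ?gt_eqF ?normal_peak_gt0 //.
by rewrite /normal_fun subr0 sqr_sqrtr // -mulr_natr; congr (_ %:E); congr expR; field.
Qed.

Lemma integrable_mul_gauss h K (A : R) : continuous h ->
  (forall x, `|h x| <= A * weight K x) ->
  mu.-integrable setT (EFin \o (fun x => h x * gauss x)).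
Proof.
move=> ch hA; have [C C0 HC] := weight_gauss_le K.
have A0 : 0 <= A.
  have := hA 0; rewrite /weight expr0n addr0 expr1n mulr1.
  by apply: le_trans.
apply: (le_integrable _ _ _ (integrableZl measurableT (A * C) integrable_wide_gauss)) => //.
  apply/measurable_EFinP; apply: continuous_measurable_fun => x.
  by apply: cvgM; [exact: ch|exact: continuous_gauss].
move=> x _; rewrite /= lee_fin !normrM (ger0_norm (gauss_ge0 x)).
rewrite (ger0_norm (expR_ge0 _)) (ger0_norm A0) (ger0_norm C0).
apply: le_trans (_ : A * weight K x * gauss x <= _).
  by apply: ler_wpM2r; [exact: gauss_ge0|exact: hA].
by rewrite -[leLHS]mulrA -[leRHS]mulrA; apply: ler_wpM2l; [exact: A0|exact: HC].
Qed.

Lemma continuous_weight K : continuous (@weight R K).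
Proof.
have -> : @weight R K = horner ((1 + 'X^2) ^+ K).
  by apply/funext => x; rewrite horner_exp hornerD hornerC hornerXn.
exact: continuous_horner.
Qed.

Lemma integrable_weight_gauss K :
  mu.-integrable setT (EFin \o (fun x => weight K x * gauss x)).
Proof.
apply: (@integrable_mul_gauss _ K 1); first exact: continuous_weight.
by move=> x; rewrite mul1r ger0_norm ?weight_ge0.
Qed.

Lemma integrable_gauss : mu.-integrable setT (EFin \o @gauss R).
Proof.
have := integrable_weight_gauss 0; apply: eq_integrable => // x _.
by rewrite /= /weight expr0 mul1r.
Qed.

Lemma integral_gauss : (\int[mu]_x gauss x)%R = Num.sqrt (2 * pi).
Proof.
have p0 : 0 < Num.sqrt (2 * pi) :> R by rewrite sqrtr_gt0 mulr_gt0 ?pi_gt0.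
have E : (\int[mu]_x ((Num.sqrt (2 * pi))^-1 * gauss x))%R = 1.
  rewrite /Rintegral -[RHS]/(fine 1%:E) -(integral_normal_pdf (0:R) 1); congr fine.
  apply: eq_integral => x _; rewrite normal_pdfE ?oner_eq0 //.
  rewrite /normal_peak /normal_fun subr0 expr1n mul1r mulr_natl /gauss.
  by congr (_ * expR _)%:E; rewrite mulNr.
rewrite RintegralZl // in E; last exact: integrable_gauss.
have p1 : Num.sqrt (2 * pi) != 0 :> R by rewrite gt_eqF.
by apply: (mulfI (invr_neq0 p1)); rewrite E mulVf.
Qed.

Lemma cvg_weight_gauss K : weight K x * gauss x @[x --> +oo] --> (0 : R).
Proof.
have [C C0 HC] := weight_gauss_le K.+1.
apply: (@squeeze_cvgr _ _ _ _ (cst 0) (fun x => C * x^-1)); last 2 first.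
- exact: cvg_cst.
- rewrite -[X in _ --> X](mulr0 C); apply: cvgMl_tmp.
  apply/(gtr0_cvgV0 (f := fun x : R => x)); last exact: cvg_id.
  by near=> x; near: x; exact: nbhs_pinfty_gt.
near=> x; rewrite mulr_ge0 ?weight_ge0 ?gauss_ge0 //=.
have x0 : 0 < x by near: x; exact: nbhs_pinfty_gt.
rewrite ler_pdivlMr // mulrAC.
apply: le_trans (_ : weight K.+1 x * gauss x <= _).
  rewrite ler_wpM2r ?gauss_ge0 // -addn1 weightD ler_wpM2l ?weight_ge0 //.
  by apply: le_trans (norm_le_weight1 x); apply: ler_norm.
apply: le_trans (HC x) _; rewrite -[leRHS]mulr1 ler_wpM2l // -expR0 ler_expR.
by rewrite oppr_le0 divr_ge0 ?sqr_ge0.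
Unshelve. all: by end_near. Qed.

Lemma is_derive_weight_gauss K x :
  is_derive x 1 (fun y => - 2 * (weight K y * gauss y))
    (2 * x * gauss x * (weight K x - 2 * K%:R * weight K.-1 x)).
Proof.
have -> : (fun y => - 2 * (weight K y * gauss y)) =
    horner (- 2 *: (1 + 'X^2) ^+ K) * @gauss R.
  apply/funext => y; rewrite fctE hornerZ horner_exp hornerD hornerC hornerXn.
  by rewrite mulrA.
have := is_deriveM (is_derive_poly (- 2 *: (1 + 'X^2) ^+ K) x) (is_derive_gauss x).
move=> /is_derive_eq; apply.
rewrite derivZ deriv_exp derivD (derivC 1) derivXn add0r.
rewrite !hornerZ -[_ *+ K]mulr_natl hornerM -polyC_natr hornerC hornerM hornerMn.
rewrite !horner_exp hornerD hornerC !hornerXn /weight /GRing.scale /= expr1.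
by rewrite hornerX; ring.
Qed.

(** Beyond [4 * K + 1] the derivative of [- 2 * weight K * gauss] is at least
    [weight K * gauss], because the term [x * weight K] wins over the derivative of
    the weight. *)
Lemma tail_weight_gauss K x : (4 * K)%:R + 1 <= x ->
  \int[mu]_(t in `[x, +oo[) (weight K t * gauss t) <= 2 * (weight K x * gauss x).
Proof.
move=> Kx; pose f (t : R) := 2 * t * gauss t * (weight K t - 2 * K%:R * weight K.-1 t).
have wf t : x <= t -> weight K t * gauss t <= f t.
  move=> xt; have K0 : 0 <= K%:R :> R by [].
  rewrite natrM in Kx.
  have t1 : 1 <= t by lra.
  have H : 2 * K%:R * weight K.-1 t <= weight K t / 2.
    case: (K) Kx K0 => [_ _|k Kx K0].
      by rewrite mulr0n mulr0 mul0r divr_ge0 ?weight_ge0.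
    have -> : weight k.+1 t = weight k t * weight 1 t by rewrite -weightD addn1.
    rewrite /=.
    rewrite -[leRHS]mulrA [weight 1 t]expr1 mulrC.
    rewrite ler_wpM2l ?weight_ge0 //.
    have : t <= t ^+ 2 by rewrite expr2 ler_peMl; lra.
    lra.
  rewrite /f; move: H; set D := 2 * K%:R * _ => H.
  have -> : 2 * t * gauss t * (weight K t - D) = (2 * t * (weight K t - D)) * gauss t by ring.
  apply: ler_wpM2r; first exact: gauss_ge0.
  have w0 := weight_ge0 K t.
  apply: le_trans (_ : t * weight K t <= _); first by rewrite ler_peMl.
  rewrite [2 * t]mulrC -mulrA; apply: ler_wpM2l; lra.
have -> : 2 * (weight K x * gauss x) = 0 - (- 2 * (weight K x * gauss x)) by ring.
have f0 t : x <= t -> 0 <= f t.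
  by move=> /wf; apply: le_trans; rewrite mulr_ge0 ?weight_ge0 ?gauss_ge0.
have cf : continuous f.
  have cw k : continuous (@weight R k) by exact: continuous_weight.
  move=> t; apply: cvgM; last first.
    by apply: cvgB; [exact: cw|apply: cvgM; [exact: cvg_cst|exact: cw]].
  apply: cvgM; last exact: continuous_gauss.
  by apply: cvgM; [exact: cvg_cst|exact: cvg_id].
have cG : continuous (fun y => - 2 * (weight K y * gauss y)).
  by apply: continuous_of_derive => y; exact: is_derive_weight_gauss.
have FTC : (\int[mu]_(t in `[x, +oo[) (f t)%:E =
    0%:E - (- 2 * (weight K x * gauss x))%:E)%E.
  apply: (@ge0_continuous_FTC2y R f (fun y => - 2 * (weight K y * gauss y))) => //.
  - exact: continuous_subspaceT.
  - rewrite -[X in _ --> X](mulr0 (- 2)); apply: cvgMl_tmp; exact: cvg_weight_gauss.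
  - by move=> t _; case: (is_derive_weight_gauss K t).
  - by apply: cvg_at_right_filter; exact: cG.
  - move=> t _; rewrite derive1E; by case: (is_derive_weight_gauss K t).
rewrite -lee_fin EFinB -FTC /Rintegral fineK; last first.
  apply: integrable_fin_num => //.
  exact: integrableS (integrable_weight_gauss K).
apply: ge0_le_integral => //.
- by move=> t _; rewrite lee_fin mulr_ge0 ?weight_ge0 ?gauss_ge0.
- apply/measurable_EFinP; apply: measurable_funTS; apply: continuous_measurable_fun => t.
  by apply: cvgM; [exact: continuous_weight|exact: continuous_gauss].
- by apply/measurable_EFinP; apply: measurable_funTS; apply: continuous_measurable_fun.
- by move=> t; rewrite /= in_itv /= andbT lee_fin => /wf.
Qed.

End GaussianStein.

(** * The Stein equation *)

Section SteinBound.
Variable R : realType.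
Implicit Types (h f : R -> R) (x y : R).
Local Notation mu := (@lebesgue_measure R).

Lemma left_tail_weight_gauss K x : x <= - ((4 * K)%:R + 1) ->
  \int[mu]_(t in `]-oo, x]) (weight K t * gauss t) <= 2 * (weight K x * gauss x).
Proof.
move=> xK; have ev y : weight K (- y) * gauss (- y) = weight K y * gauss y.
  by rewrite /weight /gauss sqrrN.
have -> : \int[mu]_(t in `]-oo, x]) (weight K t * gauss t) =
   \int[mu]_(t in `[- x, +oo[) (weight K t * gauss t).
  rewrite /Rintegral -[in LHS](opprK x) ge0_integration_by_substitutionNy.
  - by congr fine; apply: eq_integral => t _; rewrite /= ev.
  - apply: continuous_subspaceT => t.
    by apply: cvgM; [exact: continuous_weight|exact: continuous_gauss].
  - by move=> t _; rewrite mulr_ge0 ?weight_ge0 ?gauss_ge0.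
by rewrite -ev tail_weight_gauss // lerNr.
Qed.

(** The solution is [exp (x ^ 2 / 2)] times the primitive from [-oo] of
    [(h - c) * gauss].  It is bounded on compact sets; far out, the Gaussian tails
    compensate the exponential factor, on the right because [c] makes the total
    integral of [(h - c) * gauss] vanish. *)
Lemma stein_solution h K (A : R) : continuous h ->
  (forall x, `|h x| <= A * weight K x) ->
  let c := \int[mu]_x (h x * gauss x) / Num.sqrt (2 * pi) in
  exists f (B : R), [/\ 0 <= B,
    forall x, is_derive x 1 f (x * f x + (h x - c)) &
    forall x, `|f x| <= B * weight K x].
Proof.
move=> ch hA c; pose k x := h x - c.
have ck : continuous k by move=> x; apply: cvgB; [exact: ch|exact: cvg_cst].
pose A' := A + `|c|.
have kA x : `|k x| <= A' * weight K x.
  apply: le_trans (ler_normB _ _) _; rewrite mulrDl; apply: lerD => //.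
  by rewrite ler_peMr // weight_ge1.
have A'0 : 0 <= A'.
  have := kA 0; rewrite /weight expr0n addr0 expr1n mulr1.
  by apply: le_trans.
pose kg x := k x * gauss x.
have ckg : continuous kg.
  by move=> x; apply: cvgM; [exact: ck|exact: continuous_gauss].
have ikg : mu.-integrable setT (EFin \o kg) by exact: integrable_mul_gauss kA.
have ikgD (D : set (measurableTypeR R)) : measurable D -> mu.-integrable D (EFin \o kg).
  by move=> mD; apply: integrableS ikg.
have iwgD (D : set (measurableTypeR R)) : measurable D ->
    mu.-integrable D (EFin \o (fun t => A' * (weight K t * gauss t))).
  move=> mD; apply: (integrableS measurableT) => //.
  exact: (integrableZl measurableT A' (integrable_weight_gauss R K)).
have total : \int[mu]_x kg x = 0.
  have ih : mu.-integrable setT (EFin \o (fun x => h x * gauss x)).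
    exact: integrable_mul_gauss hA.
  have ic : mu.-integrable setT (EFin \o (fun x => c * gauss x)).
    exact: (integrableZl measurableT c (integrable_gauss R)).
  rewrite (_ : kg = fun x => h x * gauss x - c * gauss x); last first.
    by apply/funext => x; rewrite /kg /k mulrBl.
  rewrite RintegralB // RintegralZl //; last exact: integrable_gauss.
  rewrite integral_gauss /c divfK ?subrr // gt_eqF // sqrtr_gt0 mulr_gt0 //.
  exact: pi_gt0.
pose F x := \int[mu]_(t in `]-oo, x]) kg t.
have dF x : is_derive x 1 F (kg x).
  have [||||d e] := @continuous_FTC1 R kg -oo%O x (x + 1).
  - by rewrite ltrDl.
  - exact: ikgD.
  - by rewrite ltNyr.
  - exact: ckg.
  - by apply: DeriveDef; [exact: d|rewrite -derive1E; exact: e].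
have F_le (D : set (measurableTypeR R)) : measurable D ->
    `|\int[mu]_(t in D) kg t| <= \int[mu]_(t in D) (A' * (weight K t * gauss t)).
  move=> mD; apply: le_trans (le_normr_Rintegral mD (ikgD D mD)) _.
  apply: le_Rintegral => //; first exact: integrable_norm (ikgD D mD).
  - exact: iwgD.
  - move=> t _; rewrite /kg normrM (ger0_norm (gauss_ge0 _)) mulrA.
    by apply: ler_wpM2r; [exact: gauss_ge0|exact: kA].
have iw (D : set (measurableTypeR R)) : measurable D ->
    mu.-integrable D (EFin \o (fun t => weight K t * gauss t)).
  by move=> mD; apply: integrableS (integrable_weight_gauss R K).
pose M := \int[mu]_t (A' * (weight K t * gauss t)).
have wg0 t : 0 <= A' * (weight K t * gauss t).
  by rewrite !mulr_ge0 ?weight_ge0 ?gauss_ge0.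
have F_M x : `|F x| <= M.
  apply: le_trans (F_le _ _) _; first exact: measurable_itv.
  rewrite /M -(setUv `]-oo, x]) Rintegral_setU //.
  - by rewrite lerDl; apply: Rintegral_ge0.
  - exact: measurableC.
  - by rewrite setUv; exact: iwgD.
  - by apply/disj_setPS => t [].
have right x : (4 * K)%:R + 1 <= x -> `|F x| <= 2 * A' * (weight K x * gauss x).
  move=> Kx; have E : F x = - \int[mu]_(t in `]x, +oo[) kg t.
    have := @Rintegral_itvB R kg -oo%O +oo%O x.
    rewrite set_itvNyy total => <- //; first by rewrite sub0r opprK.
  rewrite E normrN; apply: le_trans (F_le _ _) _; first exact: measurable_itv.
  rewrite RintegralZl //; last exact: iw.
  rewrite Rintegral_itv_obnd_cbnd; last exact: iw.
  rewrite -mulrA mulrCA; apply: ler_wpM2l => //; exact: tail_weight_gauss.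
have left x : x <= - ((4 * K)%:R + 1) -> `|F x| <= 2 * A' * (weight K x * gauss x).
  move=> Kx; apply: le_trans (F_le _ _) _; first exact: measurable_itv.
  rewrite RintegralZl //; last exact: iw.
  rewrite -mulrA mulrCA; apply: ler_wpM2l => //; exact: left_tail_weight_gauss.
pose e x := expR (x ^+ 2 / 2).
have ge1 x : gauss x * e x = 1 by rewrite /gauss /e -expRD addNr expR0.
have e0 x : 0 <= e x by exact: expR_ge0.
pose x0 : R := (4 * K)%:R + 1.
have M0 : 0 <= M by exact: Rintegral_ge0.
exists (F * e), (2 * A' + M * e x0); split.
- by rewrite addr_ge0 ?mulr_ge0.
- move=> x; have de : is_derive x 1 e (x * e x).
    have -> : e = expR \o horner (2^-1 *: 'X^2).
      by apply/funext => z; rewrite /e /= hornerZ hornerXn; congr expR; ring.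
    apply: is_derive_eq.
    rewrite derivZ derivXn hornerZ hornerMn /= hornerX hornerZ hornerXn.
    by rewrite mulrC; congr (_ * _); field.
  have := is_deriveM (dF x) de; move=> /is_derive_eq; apply.
  rewrite /GRing.scale /= fctE /kg [e x * _]mulrC -mulrA ge1 mulr1 /k; ring.
- move=> x; rewrite fctE normrM (ger0_norm (e0 x)).
  have tail : `|F x| <= 2 * A' * (weight K x * gauss x) ->
      `|F x| * e x <= (2 * A' + M * e x0) * weight K x.
    move=> H; apply: le_trans (_ : 2 * A' * (weight K x * gauss x) * e x <= _).
      exact: ler_wpM2r.
    have -> : 2 * A' * (weight K x * gauss x) * e x =
        2 * A' * weight K x * (gauss x * e x) by ring.
    rewrite ge1 mulr1 [leRHS]mulrDl lerDl mulr_ge0 ?weight_ge0 //.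
    by rewrite mulr_ge0.
  case: (lerP x0 x) => [/right/tail //|xx0].
  case: (lerP x (- x0)) => [/left/tail //|x0x].
  apply: le_trans (_ : M * e x0 <= _).
    apply: ler_pM => //; rewrite /e ler_expR ler_wpM2r ?invr_ge0 //.
    rewrite -[x ^+ 2]real_normK ?num_real // lerXn2r ?nnegrE //.
      by rewrite /x0 addr_ge0.
    by rewrite ler_norml; apply/andP; split; exact: ltW.
  apply: le_trans (_ : (2 * A' + M * e x0) * 1 <= _).
    by rewrite mulr1 lerDr mulr_ge0.
  by apply: ler_wpM2l (weight_ge1 K x); rewrite addr_ge0 ?mulr_ge0.
Qed.

End SteinBound.

(** * A central limit theorem with rate *)

Section CentralLimit.
Variable R : realType.
Implicit Types (h f : R -> R) (x y : R).
Local Notation mu := (@lebesgue_measure R).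

Lemma weight_between K x y z : x <= z <= y -> weight K z <= weight K x + weight K y.
Proof.
move=> /andP[xz zy].
have mono (a b : R) : `|a| <= `|b| -> weight K a <= weight K b.
  move=> ab; apply: lerXn2r; rewrite ?nnegrE ?addr_ge0 ?sqr_ge0 //.
  rewrite lerD2l -[a ^+ 2]real_normK ?num_real // -[b ^+ 2]real_normK ?num_real //.
  by rewrite lerXn2r ?nnegrE.
case: (lerP 0 z) => [z0|/ltW z0].
  apply: le_trans (mono z y _) _; last by rewrite lerDr weight_ge0.
  by rewrite !ger0_norm // (le_trans z0).
apply: le_trans (mono z x _) _; last by rewrite lerDl weight_ge0.
by rewrite !ler0_norm ?lerN2 // (le_trans xz).
Qed.

Definition weight_lipschitz (K : nat) (B : R) f :=
  forall x y, x <= y -> `|f y - f x| <= B * (y - x) * (weight K x + weight K y).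

Lemma derive_weight_lipschitz K B f f' :
  (forall x, is_derive x 1 f (f' x)) -> (forall x, `|f' x| <= B * weight K x) ->
  weight_lipschitz K B f.
Proof.
move=> df bf x y xy.
have [z zxy ->] : exists2 c, c \in `[x, y]%R & f y - f x = f' c * (y - x).
  apply: MVT_segment => //.
  by apply: continuous_subspaceT; exact: continuous_of_derive df.
have B0 : 0 <= B.
  have := bf 0; rewrite /weight expr0n addr0 expr1n mulr1.
  by apply: le_trans.
have yx0 : 0 <= y - x by rewrite subr_ge0.
rewrite normrM (ger0_norm yx0) mulrAC; apply: ler_wpM2r => //.
apply: le_trans (bf z) _; apply: ler_wpM2l => //.
by apply: weight_between; move: zxy; rewrite in_itv.
Qed.

(** The trapezoidal rule, with an error of second order only, as [f'] is merely
    locally Lipschitz. *)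
Lemma stein_defect_bound f f' W :
  (forall x, is_derive x 1 f (f' x)) ->
  (forall x y z, x <= z <= y ->
     `|f' z - f' x| <= (y - x) * (W x + W y) /\
     `|f' z - f' y| <= (y - x) * (W x + W y)) ->
  forall x y, x < y ->
     `|f y - f x - (y - x) * (f' x + f' y) / 2| <= (y - x) ^+ 2 * (W x + W y).
Proof.
move=> df Lf x y xy.
have [z zxy ->] : exists2 c, c \in `[x, y]%R & f y - f x = f' c * (y - x).
  apply: MVT_segment => //; first exact: ltW.
  by apply: continuous_subspaceT; exact: continuous_of_derive df.
rewrite in_itv in zxy; have [H1 H2] := Lf _ _ _ zxy.
have yx0 : 0 <= y - x by rewrite subr_ge0 ltW.
have -> : f' z * (y - x) - (y - x) * (f' x + f' y) / 2 =
    (y - x) * ((f' z - f' x) / 2 + (f' z - f' y) / 2) by field.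
rewrite normrM (ger0_norm yx0) expr2 -mulrA; apply: ler_wpM2l => //.
apply: le_trans (ler_normD _ _) _; rewrite !normrM (ger0_norm (_ : 0 <= 2^-1)) //.
by lra.
Qed.

(** Stein's method: [h] minus its Gaussian mean is [f' - x f] for the [f] of
    [stein_solution], and the standardized binomial law almost annihilates
    [f' - x f].  The equation itself upgrades the growth bound on [f] to one on [f'],
    hence to a local Lipschitz bound on [x f], and so on [f']. *)
Lemma binomial_clt h K (A B : R) : continuous h -> 0 <= B ->
  (forall x, `|h x| <= A * weight K x) -> weight_lipschitz K B h ->
  exists2 C : R, 0 <= C & forall N,
    `|binomial_mean N.+1 h - \int[mu]_x (h x * gauss x) / Num.sqrt (2 * pi)|
    <= C / Num.sqrt N.+1%:R.
Proof.
move=> ch B0 hA Lh; have [f [D [D0 df fD]]] := stein_solution ch hA.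
set c := _ / Num.sqrt (2 * pi) in df *.
pose p x := x * f x; pose f' x := p x + (h x - c).
have A0 : 0 <= A.
  have := hA 0; rewrite /weight expr0n addr0 expr1n mulr1.
  by apply: le_trans.
have pD x : `|p x| <= D * weight K.+1 x.
  rewrite normrM -add1n weightD mulrCA; apply: ler_pM => //.
  exact: norm_le_weight1.
pose E := D + (A + `|c|).
have E0 : 0 <= E by rewrite !addr_ge0.
have f'E x : `|f' x| <= E * weight K.+1 x.
  apply: le_trans (ler_normD _ _) _; rewrite mulrDl; apply: lerD; first exact: pD.
  apply: le_trans (ler_normB _ _) _; rewrite mulrDl; apply: lerD.
    by apply: le_trans (hA x) _; apply: ler_wpM2l => //; exact: le_weight.
  by rewrite ler_peMr // weight_ge1.
have dp x : is_derive x 1 p (f x + x * f' x).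
  have := is_deriveM (is_derive_id x 1) (df x); move=> /is_derive_eq; apply.
  by rewrite /GRing.scale /= mulr1 addrC /f' /p.
have p'b x : `|f x + x * f' x| <= (D + E) * weight K.+2 x.
  apply: le_trans (ler_normD _ _) _; rewrite mulrDl; apply: lerD.
    apply: le_trans (fD x) _; apply: ler_wpM2l => //; apply: le_weight.
    by rewrite -addn2 leq_addr.
  rewrite normrM -[K.+2]add1n weightD mulrCA; apply: ler_pM => //.
  exact: norm_le_weight1.
have Lp := derive_weight_lipschitz dp p'b.
pose W x := 2 * (D + E + B) * weight K.+2 x.
have DEB : 0 <= D + E + B by rewrite !addr_ge0.
have Lf' x y : x <= y ->
    `|f' y - f' x| <= (D + E + B) * (y - x) * (weight K.+2 x + weight K.+2 y).
  move=> xy; have -> : f' y - f' x = (p y - p x) + (h y - h x) by rewrite /f'; ring.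
  apply: le_trans (ler_normD _ _) _; rewrite -mulrA mulrDl !mulrA.
  apply: lerD; first exact: Lp.
  apply: le_trans (Lh _ _ xy) _; apply: ler_wpM2l.
    by rewrite mulr_ge0 // subr_ge0.
  by apply: lerD; apply: le_weight; rewrite -addn2 leq_addr.
have L2 x y z : x <= z <= y ->
     `|f' z - f' x| <= (y - x) * (W x + W y) /\
     `|f' z - f' y| <= (y - x) * (W x + W y).
  move=> xzy; have /andP[xz zy] := xzy.
  have wz := weight_between K.+2 xzy.
  have x0 := weight_ge0 K.+2 x; have y0 := weight_ge0 K.+2 y.
  have z0 := weight_ge0 K.+2 z.
  have -> : (y - x) * (W x + W y) =
     (D + E + B) * (y - x) * (2 * weight K.+2 x + 2 * weight K.+2 y).
    by rewrite /W; ring.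
  have zx0 : 0 <= z - x by rewrite subr_ge0.
  have yz0 : 0 <= y - z by rewrite subr_ge0.
  split.
    apply: le_trans (Lf' _ _ xz) _; apply: ler_pM.
    - by rewrite mulr_ge0.
    - by rewrite addr_ge0.
    - by apply: ler_wpM2l => //; rewrite lerD2r.
    - by lra.
  rewrite distrC; apply: le_trans (Lf' _ _ zy) _; apply: ler_pM.
  - by rewrite mulr_ge0.
  - by rewrite addr_ge0.
  - by apply: ler_wpM2l => //; rewrite lerD2l lerN2.
  - by lra.
have [C C0 HC] := weight_mean_bounded R K.+2.
exists (4 * (2 * (D + E + B) * C)) => [|N]; first by rewrite !mulr_ge0.
have := binomial_mean_stein_bound N (stein_defect_bound df L2).
have -> : binomial_mean N.+1 (fun x => x * f x - (x * f x + (h x - c))) =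
   c - binomial_mean N.+1 h.
  rewrite -[c in RHS](binomial_mean_cst N.+1) -sumrB; apply: eq_bigr => k _; ring.
rewrite distrC => /le_trans; apply.
rewrite binomial_meanZ [leLHS]mulrAC; apply: ler_wpM2r; first by rewrite invr_ge0.
by apply: ler_wpM2l => //; apply: ler_wpM2l; rewrite ?mulr_ge0.
Qed.

Lemma poly_weight_bound (q : {poly R}) : exists2 A : R, 0 <= A &
  forall K x, (size q <= K)%N -> `|q.[x]| <= A * weight K x.
Proof.
elim/poly_ind: q => [|q a [A A0 HA]].
  by exists 0 => // K x _; rewrite horner0 normr0 mul0r.
exists (A + `|a|) => [|K x qK]; first by rewrite addr_ge0.
rewrite hornerMXaddC; apply: le_trans (ler_normD _ _) _; rewrite mulrDl.
apply: lerD; last by rewrite ler_peMr // weight_ge1.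
have [->|q0] := eqVneq q 0.
  by rewrite horner0 mul0r normr0 mulr_ge0 ?weight_ge0.
case: K qK => [|K] qK; first by move: qK; rewrite size_MXaddC (negPf q0).
have {}qK : (size q <= K)%N by move: qK; rewrite size_MXaddC (negPf q0).
rewrite normrM -addn1 weightD mulrA; apply: ler_pM => //; first exact: HA.
exact: norm_le_weight1.
Qed.

Lemma abs_poly_clt (q : {poly R}) : exists2 C : R, 0 <= C & forall N,
    `|binomial_mean N.+1 (fun x => `|q.[x]|) -
      \int[mu]_x (`|q.[x]| * gauss x) / Num.sqrt (2 * pi)|
    <= C / Num.sqrt N.+1%:R.
Proof.
have [A A0 HA] := poly_weight_bound q.
have [B B0 HB] := poly_weight_bound q^`().
pose K := maxn (size q) (size q^`()).
apply: (@binomial_clt (fun x => `|q.[x]|) K A B) => //.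
- move=> x; apply: (@continuous_comp _ _ _ (horner q) (fun z => `|z|)).
    exact: continuous_horner.
  exact: norm_continuous.
- by move=> x; rewrite normr_id HA // leq_maxl.
have L : weight_lipschitz K B (horner q).
  apply: (derive_weight_lipschitz (is_derive_poly q)) => x.
  by rewrite HB // leq_maxr.
move=> x y xy; apply: le_trans (L _ _ xy).
exact: ler_dist_dist.
Qed.

End CentralLimit.

(** * Differences of the binomial distribution *)

Section Differences.
Variable R : realType.
Local Notation u := (fair_bit R).
Local Notation t := ('X - 1 : {poly R}).
Local Notation w := (1 + 'X : {poly R}).
Local Notation mu := (@lebesgue_measure R).

Lemma coef_difference_kraw m M k : (0 < m + M)%N ->
  (t ^+ m * u ^+ M)`_k = 2 ^+ m / Num.sqrt (m + M)%:R ^+ m *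
    (2 ^- (m + M) * 'C(m + M, k)%:R * kraw (m + M)%:R (std_point R (m + M) k) m).
Proof.
move=> mM; rewrite /fair_bit exprZn -scalerAr coefZ krawtchouk_coefE //.
set s := Num.sqrt _; have s0 : s != 0 by rewrite gt_eqF // sqrtr_gt0 ltr0n.
set a := 'C(_, _)%:R; set b := kraw _ _ _.
rewrite exprVn exprD; field.
by rewrite !expf_neq0 // pnatr_eq0.
Qed.

Lemma l1norm_le_bound n N (p : {poly R}) : (forall k, (N < k)%N -> p`_k = 0) ->
  l1norm n p <= l1norm N.+1 p.
Proof.
move=> pN; rewrite /l1norm.
have [nN|Nn] := leqP n N.+1.
  rewrite (big_ord_widen _ (fun i => `|p`_i|) nN) big_mkcond /=.
  by apply: ler_sum => i _; case: ifP.
rewrite (big_ord_widen _ (fun i => `|p`_i|) (ltnW Nn)) [leRHS]big_mkcond /=.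
apply: ler_sum => i _; case: ifPn => //; rewrite -leqNgt => Ni.
by rewrite pN // normr0.
Qed.

Lemma l1norm_difference_kraw r M : (0 < r + M)%N ->
  l1norm (r + M).+1 (t ^+ r * u ^+ M) = 2 ^+ r / Num.sqrt (r + M)%:R ^+ r *
   binomial_mean (r + M) (fun x => `|kraw (r + M)%:R x r|).
Proof.
move=> rM; rewrite mulr_sumr; apply: eq_bigr => k _.
rewrite coef_difference_kraw // normrM ger0_norm ?divr_ge0 ?exprn_ge0 ?sqrtr_ge0 //.
by rewrite normrM ger0_norm ?mulr_ge0 ?invr_ge0 ?exprn_ge0.
Qed.

(** The Krawtchouk factor has bounded mean because the moments are bounded; what
    remains is [N ^ (- r / 2)] with [N = r + M]. *)
Lemma l1norm_difference_bound r : (0 < r)%N -> exists2 C : R, 0 <= C &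
  forall n M, l1norm n (t ^+ r * u ^+ M) <= C * (Num.sqrt M.+1%:R)^-1 ^+ r.
Proof.
move=> r0; have [C1 C10 H1] := kraw_bounded R r.
have [C2 C20 H2] := weight_mean_bounded R r.
exists (2 ^+ r * (C1 * C2)) => [|n M]; first by rewrite !mulr_ge0 ?exprn_ge0.
have rM : (0 < r + M)%N by rewrite addn_gt0 r0.
apply: le_trans (@l1norm_le_bound n (r + M) _ _) _.
  by move=> k rMk; rewrite coef_difference_kraw // bin_small // mulr0 mul0r mulr0.
rewrite l1norm_difference_kraw // [leLHS]mulrAC.
have s0 : 0 < Num.sqrt M.+1%:R :> R by exact: sqrt_natS_gt0.
apply: ler_pM.
- rewrite mulr_ge0 ?exprn_ge0 //; apply: sumr_ge0 => k _.
  by rewrite !mulr_ge0 ?invr_ge0 ?exprn_ge0.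
- by rewrite invr_ge0 exprn_ge0 ?sqrtr_ge0.
- apply: ler_wpM2l; first by rewrite exprn_ge0.
  have -> : (r + M = (r + M).-1.+1)%N by lia.
  apply: le_trans (_ : C1 * binomial_mean (r + M).-1.+1 (weight r) <= _).
    rewrite -binomial_meanZ; apply: le_binomial_mean => x; apply: H1; lia.
  by apply: ler_wpM2l.
- rewrite exprVn lef_pV2 ?posrE ?exprn_gt0 // ?sqrtr_gt0 ?ltr0n //.
  rewrite lerXn2r ?nnegrE ?sqrtr_ge0 // ler_sqrt // ler_nat; lia.
Qed.

Lemma hermite_constE m : hermite_const R m = 2 ^+ m *
  (\int[mu]_x (`|(hermite_poly R m).[x]| * gauss x) / Num.sqrt (2 * pi)).
Proof.
rewrite /hermite_const mulrAC -mulrA; congr (_ * (_ / _)).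
by apply: eq_Rintegral => x _; rewrite hermiteE.
Qed.

(** The binomial law of index [N = m + l] weights the difference by a Krawtchouk
    polynomial, which is close to a Hermite polynomial; the few missing terms
    [k > l] lie in the tail. *)
Lemma l1norm_difference_asymptotics m : (0 < m)%N -> exists2 C : R, 0 <= C & forall l,
  `|l1norm l.+1 (t ^+ m * u ^+ l) -
    hermite_const R m * (Num.sqrt (m + l)%:R)^-1 ^+ m|
  <= C * (Num.sqrt (m + l)%:R)^-1 ^+ m.+1.
Proof.
move=> m0; have [C1 C10 H1] := kraw_bounded R m.
have [C2 C20 H2] := kraw_near_hermite R m.
have [C3 C30 H3] := weight_mean_bounded R m.+1.
have [C4 C40 H4] := abs_poly_clt (hermite_poly R m).
pose D := C2 + (C1 + C2) * (2 * m).+1%:R.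
have D0 : 0 <= D by rewrite addr_ge0 // mulr_ge0 // addr_ge0.
exists (2 ^+ m * (D * C3 + C4)) => [|l].
  by rewrite mulr_ge0 ?exprn_ge0 // addr_ge0 // mulr_ge0.
set N := (m + l)%N; have N0 : (0 < N)%N by rewrite /N; lia.
have mN : (m <= N)%N by rewrite /N; lia.
set s := Num.sqrt N%:R; have s0 : 0 < s by rewrite sqrtr_gt0 ltr0n.
have sE : s ^+ 2 = N%:R by rewrite sqr_sqrtr.
have N1 : 1 <= N%:R :> R by rewrite ler1n.
have s1 : 1 <= s by rewrite -sqrtr1 ler_sqrt.
set H := hermite_poly R m in H2 H4 *.
set c := \int[mu]_x (`|H.[x]| * gauss x) / Num.sqrt (2 * pi) in H4 *.
have hE : hermite_const R m = 2 ^+ m * c by rewrite hermite_constE.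
have clt : `|binomial_mean N (fun x => `|H.[x]|) - c| <= C4 / s.
  by have := H4 N.-1; rewrite prednK.
pose lead := 2 ^+ m * s^-1 ^+ m.
have lead0 : 0 <= lead by rewrite mulr_ge0 ?exprn_ge0 ?invr_ge0 ?sqrtr_ge0.
(* The points cut off satisfy [x >= sqrt N - 2 * m / sqrt N]. *)
have wge (k : nat) : (l < k)%N -> s <= (2 * m).+1%:R * weight 1 (std_point R N k).
  move=> lk; set x := std_point _ _ _.
  have xE : x * s = 2 * k%:R - N%:R by rewrite /x /std_point divfK // gt_eqF.
  have Nx : N%:R <= x * s + 2 * m%:R.
    have : l.+1%:R <= k%:R :> R by rewrite ler_nat.
    by rewrite xE /N natrD -natr1; lra.
  have sx : s <= `|x| + 2 * m%:R.
    rewrite -(ler_pM2r s0) -expr2 sE mulrDl; apply: le_trans Nx _.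
    apply: lerD; first by rewrite ler_wpM2r ?ler_norm // ltW.
    by rewrite ler_peMr // mulr_ge0.
  apply: le_trans sx _; rewrite -[(2 * m).+1%:R]natr1 natrM.
  set W := weight 1 x; have -> : (2 * m%:R + 1) * W = W + 2 * m%:R * W by ring.
  apply: lerD; first exact: norm_le_weight1.
  by rewrite ler_peMr ?mulr_ge0 // weight_ge1.
have main : `|l1norm l.+1 (t ^+ m * u ^+ l) - lead * binomial_mean N (fun x => `|H.[x]|)|
    <= lead * (D / s * binomial_mean N (weight m.+1)).
  have lN : (l.+1 <= N.+1)%N by rewrite ltnS leq_addl.
  rewrite /l1norm (big_ord_widen _ (fun i => `|(t ^+ m * u ^+ l)`_i|) lN) big_mkcond /=.
  rewrite [lead * binomial_mean _ _]mulr_sumr -sumrB.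
  rewrite -binomial_meanZ mulr_sumr; apply: le_trans (ler_norm_sum _ _ _) _.
  apply: ler_sum => k _; rewrite coef_difference_kraw // -/N -/s.
  set b := 2 ^- N * _; set x := std_point _ _ _.
  have b0 : 0 <= b by rewrite mulr_ge0 // invr_ge0 exprn_ge0.
  have -> : 2 ^+ m / s ^+ m = lead by rewrite /lead exprVn.
  have lb : 0 <= lead * b by rewrite mulr_ge0.
  rewrite [leRHS]mulrA [X in _ - X]mulrA [lead * (b * kraw _ _ _)]mulrA.
  have nE z : `|lead * b * z| = lead * b * `|z| by rewrite normrM ger0_norm.
  have kb := H1 N x N0 mN; have kh := H2 N x N0 mN.
  have wm := weight_ge0 m x; have w1 := weight_ge1 1 x.
  have wmS : weight m.+1 x = weight m x * weight 1 x by rewrite -weightD addn1.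
  have iNs : N%:R^-1 <= s^-1 
    by rewrite lef_pV2 ?posrE ?(lt_le_trans ltr01) // -sE expr2 ler_peMr // ltW.
  case: ifPn => [kl|].
    rewrite nE -mulrBr nE; apply: ler_wpM2l => //.
    apply: le_trans (ler_dist_dist _ _) _; apply: le_trans kh _.
    apply: ler_pM => //; first by rewrite divr_ge0.
      apply: ler_pM => //; rewrite ?invr_ge0 //.
      by rewrite /D lerDl mulr_ge0 // addr_ge0.
    by rewrite wmS ler_peMr.
  rewrite -leqNgt => lk; rewrite sub0r normrN nE normr_id; apply: ler_wpM2l => //.
  have Hw : `|H.[x]| <= (C1 + C2) * weight m x.
    rewrite -[H.[x]](subKr (kraw N%:R x m)).
    apply: le_trans (ler_normB _ _) _; rewrite mulrDl; apply: lerD => //.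
    apply: le_trans kh _; apply: ler_wpM2r => //.
    by rewrite ler_piMr // invf_le1 ?(lt_le_trans ltr01).
  apply: le_trans Hw _; rewrite mulrAC ler_pdivlMr //.
  apply: le_trans (_ : (C1 + C2) * (2 * m).+1%:R * weight m.+1 x <= _); last first.
    by rewrite ler_wpM2r ?weight_ge0 // /D lerDr.
  rewrite wmS -[leLHS]mulrA -[leRHS]mulrA ler_wpM2l ?addr_ge0 // mulrCA.
  by apply: ler_wpM2l => //; exact: wge.
have -> : hermite_const R m * s^-1 ^+ m = lead * c by rewrite hE /lead; ring.
have E2 : 2 ^+ m * (D * C3 + C4) * s^-1 ^+ m.+1 = lead * (D / s * C3) + lead * (C4 / s).
  by rewrite /lead exprS; ring.
rewrite E2; apply: le_trans (ler_distD (lead * binomial_mean N (fun x => `|H.[x]|)) _ _) _.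
apply: lerD.
  apply: le_trans main _; apply: ler_wpM2l => //; apply: ler_wpM2l.
    by rewrite divr_ge0 // ltW.
  by have := H3 N.-1; rewrite prednK.
by rewrite -mulrBr normrM ger0_norm //; apply: ler_wpM2l.
Qed.

End Differences.

(** * The total variation estimate *)

Section Assembly.
Variable R : realType.
Local Notation u := (fair_bit R).
Local Notation t := ('X - 1 : {poly R}).

(** [(l - d + 1) * (d + 1)] is concave in [d], hence at least its value [l + 1] at both
    ends of the range. *)
Lemma inv_sqrt_sub_le l d : (d <= l)%N ->
  (Num.sqrt (l - d).+1%:R)^-1 <= d.+1%:R * (Num.sqrt l.+1%:R)^-1 :> R.
Proof.
move=> dl; rewrite ler_pdivlMr ?sqrtr_gt0 ?ltr0n // mulrC.
rewrite ler_pdivrMr ?sqrtr_gt0 ?ltr0n //.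
have -> : d.+1%:R = Num.sqrt (d.+1%:R ^+ 2) :> R by rewrite sqrtr_sqr ger0_norm.
rewrite -sqrtrM ?exprn_ge0 // ler_sqrt ?mulr_ge0 ?exprn_ge0 //.
rewrite -natrX -natrM ler_nat; nia.
Qed.

(** A bit of relative weight [2 ^ - d] leaves [l - d] free digits; replacing
    [l - d] by [l] costs only a factor polynomial in [d]. *)
Lemma l1norm_remainder m : exists2 C : R, 0 <= C & forall n, (0 < n)%N ->
  l1norm (floor_log2 n).+1 (n%:R^-1 *: digit_poly R n
     - \sum_(i < m.+1) expansion_coef R i n *: (t ^+ i * u ^+ floor_log2 n))
  <= C * (Num.sqrt (floor_log2 n).+1%:R)^-1 ^+ m.+1.
Proof.
have [C1 C10 H1] := l1norm_difference_bound R (ltn0Sn m).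
have [C2 C20 H2] := sum_geometric_power R (m.+1 + m.+1).
exists (2 ^+ m.+1 * C1 * C2) => [|n n0]; first by rewrite !mulr_ge0 ?exprn_ge0.
have [a [w [ad wd GE]]] := normalized_digit_poly_expansion R n0.
rewrite (prob_digits_remainder m.+1 GE); set l := floor_log2 n in wd *.
set s := Num.sqrt l.+1%:R; have s0 : 0 < s by exact: sqrt_natS_gt0.
apply: le_trans (l1norm_sum _ _ _) _.
apply: (@le_trans _ _ (2 ^+ m.+1 * C1 *
  (\sum_(d < l.+1) 2 ^- d * d.+1%:R ^+ (m.+1 + m.+1)) * s^-1 ^+ m.+1)); last first.
  apply: ler_wpM2r; first by rewrite exprn_ge0 // invr_ge0 ltW.
  by apply: ler_wpM2l; rewrite ?mulr_ge0 ?exprn_ge0.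
rewrite mulr_sumr mulr_suml; apply: ler_sum => d _.
have dl : (d <= l)%N by rewrite -ltnS.
have /andP[w0 w2] := wd d dl.
rewrite l1normZ (ger0_norm w0).
have -> : 2 ^+ m.+1 * C1 * (2 ^- d * d.+1%:R ^+ (m.+1 + m.+1)) * s^-1 ^+ m.+1 =
    2 ^- d * ((2 * d.+1%:R) ^+ m.+1 * (C1 * (d.+1%:R * s^-1) ^+ m.+1)).
  by rewrite !exprMn exprD; ring.
apply: ler_pM => //; first exact: l1norm_ge0.
have := @l1norm_taylor_remainder R l.+1 m.+1 0 (a d) d d l (ad d) (leqnn d) dl.
rewrite expr0 mul1r add0n => H; apply: le_trans H _.
apply: ler_pM; rewrite ?exprn_ge0 ?l1norm_ge0 //.
  by rewrite lerXn2r ?nnegrE ?mulr_ge0 // -natrM ler_nat leq_mul.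
apply: le_trans (H1 _ _) _; apply: ler_wpM2l => //.
apply: lerXn2r; rewrite ?nnegrE ?invr_ge0 ?sqrtr_ge0 ?mulr_ge0 ?invr_ge0 ?sqrtr_ge0 //.
exact: inv_sqrt_sub_le.
Qed.

Lemma sum_prob_digits_l1norm m n :
  \sum_(k < (floor_log2 n).+1)
     `| prob_digits R n k - \sum_(r < m) (-1) ^+ r * expansion_coef R r n *
           2 ^- floor_log2 n * diff_binomial R r (floor_log2 n) k | =
  l1norm (floor_log2 n).+1 (n%:R^-1 *: digit_poly R n
     - \sum_(i < m) expansion_coef R i n *: (t ^+ i * u ^+ floor_log2 n)).
Proof.
apply: eq_bigr => k _; rewrite coefB coef_digit_poly coef_sum; congr `|_ - _|.
by apply: eq_bigr => r _; rewrite coefZ coef_difference; ring.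
Qed.

(** This trades the index [m + lambda] of the binomial law for [log2 n]. *)
Lemma inv_power_diff (m : nat) (x y : R) : (0 < m)%N -> 1 <= x -> x <= y ->
  y ^+ 2 - x ^+ 2 <= m%:R ->
  `|y^-1 ^+ m - x^-1 ^+ m| <= m%:R ^+ 2 * x^-1 ^+ m.+1.
Proof.
move=> m0 x1 xy d.
have x0 : 0 < x by apply: lt_le_trans x1.
have y0 : 0 < y by apply: lt_le_trans xy.
have ix0 : 0 <= x^-1 by rewrite invr_ge0 ltW.
have iy0 : 0 <= y^-1 by rewrite invr_ge0 ltW.
have iyx : y^-1 <= x^-1 by rewrite lef_pV2.
have ix1 : x^-1 <= 1 by rewrite invf_le1.
rewrite distrC subrXX normrM.
have A : `|x^-1 - y^-1| <= m%:R * x^-1 ^+ 2.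
  rewrite ger0_norm ?subr_ge0 //.
  have -> : x^-1 - y^-1 = (y ^+ 2 - x ^+ 2) * ((x + y)^-1 * (x^-1 * y^-1)).
    by field; rewrite !gt_eqF // addr_gt0.
  apply: ler_pM => //.
  - by rewrite subr_ge0 lerXn2r ?nnegrE // ltW.
  - by rewrite !mulr_ge0 // invr_ge0 addr_ge0 // ltW.
  rewrite expr2 -[leRHS]mul1r; apply: ler_pM.
  - by rewrite invr_ge0 addr_ge0 // ltW.
  - by rewrite mulr_ge0.
  - by rewrite invf_le1 ?addr_gt0 //; lra.
  - by apply: ler_wpM2l.
have B : `|\sum_(i < m) x^-1 ^+ (m.-1 - i) * y^-1 ^+ i| <= m%:R * x^-1 ^+ m.-1.
  apply: le_trans (ler_norm_sum _ _ _) _.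
  rewrite -[X in X%:R * _]card_ord -sum1_card natr_sum mulr_suml.
  apply: ler_sum => i _; rewrite mul1r ger0_norm ?mulr_ge0 ?exprn_ge0 //.
  have iE : (m.-1 = (m.-1 - i) + i)%N by have := ltn_ord i; lia.
  rewrite [X in _ <= _ ^+ X]iE exprD; apply: ler_wpM2l; first by rewrite exprn_ge0.
  by rewrite lerXn2r ?nnegrE.
apply: le_trans (ler_pM _ _ A B) _ => //.
have -> : m%:R * x^-1 ^+ 2 * (m%:R * x^-1 ^+ m.-1) = m%:R ^+ 2 * x^-1 ^+ m.+1.
  by rewrite [m.+1](_ : _ = 2 + m.-1)%N ?exprD; [ring|lia].
by [].
Qed.

Lemma ln2_le1 : ln 2 <= 1 :> R.
Proof.
by rewrite -[leRHS]expRK ler_ln ?posrE ?expR_gt0 //; have := expR_ge1Dx (1 : R); lra.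
Qed.

Lemma log2_bounds n : (0 < n)%N ->
  (floor_log2 n)%:R <= log2 (n%:R : R) < (floor_log2 n).+1%:R.
Proof.
move=> n0; have n0' : 0 < n%:R :> R by rewrite ltr0n.
have l2 : 0 < ln 2 :> R by apply: ln_gt0; rewrite ltr1n.
rewrite /log2; apply/andP; split.
  rewrite ler_pdivlMr // mulr_natl -lnXn // ler_ln ?posrE ?exprn_gt0 //.
  by rewrite -natrX ler_nat trunc_logP.
rewrite ltr_pdivrMr // mulr_natl -lnXn // ltr_ln ?posrE ?exprn_gt0 //.
by rewrite -natrX ltr_nat trunc_log_ltn.
Qed.

Lemma powR_half (x : R) k : 0 <= x -> x `^ (k%:R / 2) = Num.sqrt x ^+ k.
Proof.
by move=> x0; rewrite mulrC powRrM powR12_sqrt // powR_mulrn ?sqrtr_ge0.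
Qed.

Lemma l1norm_dist n (p q : {poly R}) : `|l1norm n p - l1norm n q| <= l1norm n (p - q).
Proof.
rewrite ler_norml lerNl opprB !lerBlDr; apply/andP; split.
  rewrite -[in leLHS](subKr p q) -[X in _ <= X + _]mul1r -(normrN1 R) -l1normZ.
  by rewrite scaleN1r addrC l1normD.
by rewrite -[in leLHS](subrK q p) l1normD.
Qed.

End Assembly.

Theorem theorem2p1 (R : realType) (m : nat) (hm : (1 <= m)%N) :
  exists C : R, \forall n \near \oo,
    let lambda := floor_log2 n in
    `| \sum_(k < lambda.+1)
         `| prob_digits R n k -
            \sum_(r < m) (-1) ^+ r * expansion_coef R r n *
                         2 ^- lambda * diff_binomial R r lambda k |
       - hermite_const R m * `|expansion_coef R m n| / log2 n%:R `^ (m%:R / 2) |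
    <= C * ln n%:R `^ (- ((m%:R + 1) / 2)).
Proof.
have [A A0 HA] := expansion_coef_bounded R m.
have [C1 C10 H1] := l1norm_remainder R m.
have [C2 C20 H2] := l1norm_difference_asymptotics R hm.
exists (C1 + A * (C2 + `|hermite_const R m| * m%:R ^+ 2)).
exists 2%N => // n /= n2.
have n0 : (0 < n)%N by apply: leq_trans n2.
rewrite sum_prob_digits_l1norm.
have /andP[lo hi] := log2_bounds R n0.
set l := floor_log2 n in lo hi *; set x := log2 (n%:R : R) in lo hi *.
have l1 : (1 <= l)%N by rewrite /l /floor_log2 trunc_log_gt0.
have x1 : 1 <= x by apply: le_trans lo; rewrite ler1n.
have x0 : 0 <= x by apply: le_trans x1.
set q := Num.sqrt x.
have q1 : 1 <= q by rewrite -sqrtr1 ler_sqrt.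
have q0 : 0 < q by apply: lt_le_trans q1.
have qE : q ^+ 2 = x by rewrite sqr_sqrtr.
set s : R := Num.sqrt (m + l)%:R.
have sE : s ^+ 2 = (m + l)%:R by rewrite sqr_sqrtr.
have qs1 : q <= Num.sqrt l.+1%:R by rewrite ler_sqrt ?(ltW hi).
have qs : q <= s.
  apply: le_trans qs1 _; rewrite ler_sqrt // ler_nat; lia.
have s0 : 0 < s by apply: lt_le_trans qs.
have sq : s ^+ 2 - q ^+ 2 <= m%:R by rewrite sE qE natrD; lra.
rewrite powR_half // -/q -exprVn.
set P := l1norm _ _; set a := expansion_coef R m n.
set h := hermite_const R m in H2 *.
set B := l1norm l.+1 (('X - 1) ^+ m * fair_bit R ^+ l).
have PB : `|P - `|a| * B| <= C1 * q^-1 ^+ m.+1.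
  rewrite /B -l1normZ; apply: le_trans (l1norm_dist _ _ _) _.
  have := H1 n n0; rewrite big_ord_recr /= opprD addrA => /le_trans; apply.
  apply: ler_wpM2l => //; apply: lerXn2r; rewrite ?nnegrE ?invr_ge0 ?sqrtr_ge0 //.
  by rewrite lef_pV2 // posrE ?sqrtr_gt0 ?ltr0n.
have Bh : `|B - h * s^-1 ^+ m| <= C2 * q^-1 ^+ m.+1.
  apply: le_trans (H2 l) _; apply: ler_wpM2l => //.
  by apply: lerXn2r; rewrite ?nnegrE ?invr_ge0 ?sqrtr_ge0 // lef_pV2.
have hs : `|h * s^-1 ^+ m - h * q^-1 ^+ m| <= `|h| * m%:R ^+ 2 * q^-1 ^+ m.+1.
  rewrite -mulrBr normrM -mulrA; apply: ler_wpM2l => //.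
  exact: inv_power_diff hm q1 qs sq.
have q'0 : 0 <= q^-1 ^+ m.+1 by rewrite exprn_ge0 // invr_ge0 ltW.
set C := C1 + _; have C0 : 0 <= C.
  by rewrite addr_ge0 // mulr_ge0 // addr_ge0 // mulr_ge0 // exprn_ge0.
apply: le_trans (_ : C * q^-1 ^+ m.+1 <= _).
  have -> : P - h * `|a| * q^-1 ^+ m =
      (P - `|a| * B) + `|a| * ((B - h * s^-1 ^+ m) + (h * s^-1 ^+ m - h * q^-1 ^+ m)).
    by ring.
  apply: le_trans (ler_normD _ _) _; rewrite /C mulrDl; apply: lerD => //.
  rewrite normrM normr_id -mulrA; apply: ler_pM => //; first exact: HA.
  apply: le_trans (ler_normD _ _) _; rewrite mulrDl; exact: lerD.
apply: ler_wpM2l => //.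
have ln0 : 0 < ln n%:R :> R by apply: ln_gt0; rewrite ltr1n.
have lnx : ln n%:R <= x.
  rewrite /x /log2 ler_pdivlMr; last by apply: ln_gt0; rewrite ltr1n.
  by rewrite ler_piMr ?ln2_le1 // ltW.
rewrite powRN natr1 powR_half ?(ltW ln0) // -exprVn.
apply: lerXn2r; rewrite ?nnegrE ?invr_ge0 ?sqrtr_ge0 //.
have x_gt0 : 0 < x by apply: lt_le_trans x1.
by rewrite lef_pV2 ?posrE ?sqrtr_gt0 // ler_sqrt.
Qed.
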